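(* Let $x$ be a semi-discrete circular surface in $\mathbb{H}^3$ with unit normal $n$ in $\mathbb{S}^{2,1}$, let $\theta\in\mathbb{R}$, and set $$x_\theta:=\cosh\theta\cdot x+\sinh\theta\cdot n\in\mathbb{H}^3,\qquad n_\theta:=\sinh\theta\cdot x+\cosh\theta\cdot n\in\mathbb{S}^{2,1}.$$ Then the parallel surface $x_\theta$, with unit normal vector field $n_\theta$, satisfies the circularity condition, and its Gaussian and mean curvatures $K^x_\theta,H^x_\theta$ are related to those $K_0^x,H_0^x$ of $x$ by $$K_\theta^x=\frac{K_0^x\cosh^2\theta-H_0^x\sinh(2\theta)+\sinh^2\theta}{\cosh^2\theta-H_0^x\sinh(2\theta)+K_0^x\sinh^2\theta},\qquad H_\theta^x=\frac{-(K_0^x+1)\sinh(2\theta)+2H_0^x\cosh(2\theta)}{2\{\cosh^2\theta-H_0^x\sinh(2\theta)+K_0^x\sinh^2\theta\}}.$$ The normal $n_\theta$ also satisfies the circularity condition. In particular, if $x$ is a semi-discrete BrLW surface in $\mathbb{H}^3$ and $n$ the corresponding semi-discrete BiLW surface in $\mathbb{S}^{2,1}$, both given by the Weierstrass-type representation with constant $s\in\mathbb{R}$, then, with $s_\theta=e^{-2\theta}s$: (i) $x_\theta$ is also of Bryant type, satisfying $2s_\theta(H_\theta^x-1)+(1-s_\theta)(K_\theta^x-1)=0$, and $x_\theta$ can also be obtained from the Weierstrass-type representation (i.e. it is the BrLW surface for some choice of data); (ii) $n_\theta$ satisfies the circularity condition and is of Bianchi type, satisfying $2s_\theta(H_\theta^n-1)-(1+s_\theta)(K_\theta^n-1)=0$,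 where $K^n_\theta,H^n_\theta$ are the Gaussian and mean curvatures of $n_\theta$, and $n_\theta$ can also be obtained from the Weierstrass-type representation (i.e. it is the BiLW surface for some choice of data).
   Context: Semi-discrete maps are maps $y(k,t)$ on a subdomain of $\mathbb{Z}\times\mathbb{R}$, smooth in $t$; write $y=y(k,t)$, $y_1=y(k+1,t)$, $\partial y=\frac{d}{dt}y$, $\Delta y=y_1-y$. $\mathbb{R}^{3,1}=\{(z_1,z_2,z_3,z_0)\}$ has metric $z\circ w=z_1w_1+z_2w_2+z_3w_3-z_0w_0$ and is identified with Hermitian $2\times2$ matrices by $(z_1,z_2,z_3,z_0)\mapsto\begin{pmatrix} z_0+z_3 & z_1-iz_2 \\ z_1+iz_2 & z_0-z_3 \end{pmatrix}$, so that $z\circ z=-\det$. $\mathbb{H}^3$ is the set of vectors with $z\circ z=-1$ (both sheets) and $\mathbb{S}^{2,1}$ the set of vectors with $z\circ z=1$. Circularity condition: a semi-discrete map $y$ into $\mathbb{R}^{3,1}$ (viewed as matrices) satisfies the circularity condition if the tangent cross ratio $\partial y\cdot(\Delta y)^{-1}\cdot\partial y_1\cdot(\Delta y)^{-1}$ is a real scalar multiple of the identity matrix, at all edges where $\Delta y$ is invertible. A semi-discrete circular surface $x$ in $\mathbb{H}^3$ with unit normal $n$: maps $x$ into $\mathbb{H}^3$, $n$ into $\mathbb{S}^{2,1}$ with $x\circ n=0$, $n\circ\partial x=0$, such that $\partial x,\partial x_1,\Delta x$ lie in a $2$-plane (the tangent plane of the edge), $\partial n,\partial n_1,\Delta n$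 lie in that plane, $x$ satisfies the circularity condition, and there are real scalars (principal curvatures) with $\partial n=-\kappa\,\partial x$ and $\Delta n=-\kappa_{01}\,\Delta x$. Mixed area: for semi-discrete maps $x,y$ with $\partial x\parallel\partial y$, $\Delta x\parallel\Delta y$, $$A(x,y)=\tfrac14\big((\partial x+\partial x_1)\wedge\Delta y+(\partial y+\partial y_1)\wedge\Delta x\big),\qquad (a\wedge b)c:=(a\circ c)b-(b\circ c)a .$$ The Gaussian and mean curvatures of a surface $y$ with normal $m$ are functions on edges defined (where $A(y,y)\ne0$) by $A(m,m)=K\,A(y,y)$ and $A(y,m)=-H\,A(y,y)$. $K_0^x,H_0^x$ are those of $x$ with normal $n$; $K^x_\theta,H^x_\theta$ those of $x_\theta$ with normal $n_\theta$; $K^n_\theta,H^n_\theta$ those of $n_\theta$ with normal $x_\theta$. A semi-discrete holomorphic function is a map $g(k,t)\in\mathbb{C}$ with $\partial g$ and $\Delta g$ never zero and $\dfrac{\partial g\,\partial g_1}{(\Delta g)^2}=\dfrac{\tau(t)}{\sigma(k)}<0$ for real-valued functions $\tau$ of $t$ and $\sigma$ of $k$. Weierstrass-type representation with data $(g,s,\lambda,E)$: let $g$ be semi-discrete holomorphic, $s\in\mathbb{R}$ with $\mathcal{T}:=1+s|g|^2\neq0$ everywhere, $\lambda\in\mathbb{R}\setminus\{0\}$ with $1-\lambda\sigma\neq0$. Let $E$ be a $\mathrm{GL}_2\mathbb{C}$-valued solution, with $\det E$ real, of $$E^{-1}\Delta E=\begin{pmatrix}0&\Delta g\\ \frac{\lambda\sigma}{\Delta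 g}&0\end{pmatrix},\qquad E^{-1}\partial E=\begin{pmatrix}0&\partial g\\ \frac{\lambda\tau}{\partial g}&0\end{pmatrix},$$ let $L=\begin{pmatrix}0&\sqrt{\mathcal{T}}\\ \frac{-1}{\sqrt{\mathcal{T}}}&\frac{-s\overline g}{\sqrt{\mathcal{T}}}\end{pmatrix}$, and set $$x=\frac{\mathrm{sgn}(\mathcal{T})}{\det E}EL(\overline{EL})^t\in\mathbb{H}^3,\qquad n=\frac{\mathrm{sgn}(\mathcal{T})}{\det E}EL\begin{pmatrix}1&0\\0&-1\end{pmatrix}(\overline{EL})^t\in\mathbb{S}^{2,1}.$$ Then $x$ is called a semi-discrete BrLW surface (linear Weingarten of Bryant type) and $n$ a semi-discrete BiLW surface (linear Weingarten of Bianchi type). They satisfy $\partial x\parallel\partial n$, $\Delta x\parallel\Delta n$. *)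

(* Defs.v *)
From HB Require Import structures.
From mathcomp Require Import all_boot all_order all_algebra.
From mathcomp Require Import all_classical all_reals all_analysis.
From mathcomp Require Import complex.

Set Implicit Arguments.
Unset Strict Implicit.
Unset Printing Implicit Defensive.

Import Order.TTheory GRing.Theory Num.Theory.
Import numFieldNormedType.Exports.

Local Open Scope classical_set_scope.
Local Open Scope ring_scope.
Local Open Scope complex_scope.

Section SemiDiscrete.
Variable R : realType.

Definition cosh (a : R) : R := (expR a + expR (- a)) / 2.
Definition sinh (a : R) : R := (expR a - expR (- a)) / 2.

(** * Semi-discrete maps

    A semi-discrete map is a total function [int -> R -> V]; only its values
    over the domain [D : set (int * R)] matter.  [D] is open in Z x R, with Z
    discrete, so that [t]-derivatives at points of [D] only see [D]. *)

Definition sd_domain (D : set (int * R)) : Prop :=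
  forall k : int, open [set t | D (k, t)].

(** [edge D k t]: the edge joining the vertices (k, t) and (k + 1, t). *)
Definition edge (D : set (int * R)) (k : int) (t : R) : Prop :=
  D (k, t) /\ D (k + 1, t).

Definition Delta (V : zmodType) (y : int -> R -> V) (k : int) (t : R) : V :=
  y (k + 1) t - y k t.

Definition smooth_on (V : normedModType R) (U : set R) (f : R -> V) : Prop :=
  forall (m : nat) (t : R), U t -> derivable (derive1n m f) t 1.

Definition sd_map (V : normedModType R) (D : set (int * R))
    (y : int -> R -> V) : Prop :=
  forall k : int, smooth_on [set t | D (k, t)] (y k).

Definition pt (V : normedModType R) (y : int -> R -> V) (k : int) (t : R) : V :=
  derive1 (y k) t.

(** [R[i]] carries no normed [R]-module structure in the library: complex and
    complex-matrix valued maps are differentiated componentwise in the real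
    variable [t]. *)

Definition sd_mapC (D : set (int * R)) (g : int -> R -> R[i]) : Prop :=
  sd_map D (fun k t => complex.Re (g k t) : R^o) /\
  sd_map D (fun k t => complex.Im (g k t) : R^o).

Definition ptC (g : int -> R -> R[i]) (k : int) (t : R) : R[i] :=
  pt (fun k t => complex.Re (g k t) : R^o) k t
    +i* pt (fun k t => complex.Im (g k t) : R^o) k t.

Definition sd_mapM (D : set (int * R)) (E : int -> R -> 'M[R[i]]_2) : Prop :=
  forall i j, sd_mapC D (fun k t => E k t i j).

Definition ptM (E : int -> R -> 'M[R[i]]_2) (k : int) (t : R) : 'M[R[i]]_2 :=
  \matrix_(i, j) ptC (fun k t => E k t i j) k t.

(** * Minkowski space, with coordinates ordered as (z1, z2, z3, z0) *)

Definition lor (z w : 'rV[R]_4) : R :=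
  z 0 0 * w 0 0 + z 0 1 * w 0 1 + z 0 2 * w 0 2 - z 0 3 * w 0 3.

Definition mx2 (a b c d : R[i]) : 'M[R[i]]_2 :=
  \matrix_(i, j) if i == 0 then (if j == 0 then a else b)
                 else (if j == 0 then c else d).

Definition herm (z : 'rV[R]_4) : 'M[R[i]]_2 :=
  mx2 (z 0 3 + z 0 2)%:C    (z 0 0 -i* z 0 1)
      (z 0 0 +i* z 0 1)     (z 0 3 - z 0 2)%:C.

(** * Circular surfaces *)

Definition tangent_cross_ratio (y : int -> R -> 'rV[R]_4) (k : int) (t : R) :
    'M[R[i]]_2 :=
  herm (pt y k t) *m invmx (herm (Delta y k t)) *m
  herm (pt y (k + 1) t) *m invmx (herm (Delta y k t)).

Definition circularity (D : set (int * R)) (y : int -> R -> 'rV[R]_4) : Prop :=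
  forall k t, edge D k t -> herm (Delta y k t) \in unitmx ->
    exists c : R, tangent_cross_ratio y k t = (c%:C)%:M.

(** [x] maps into H^3, with unit normal field [n] into S^{2,1}, and every edge
    has a tangent plane. *)
Definition unit_normal (D : set (int * R)) (x n : int -> R -> 'rV[R]_4) : Prop :=
  [/\ sd_map D x, sd_map D n,
      (forall k t, D (k, t) ->
         [/\ lor (x k t) (x k t) = -1, lor (n k t) (n k t) = 1,
             lor (x k t) (n k t) = 0 & lor (n k t) (pt x k t) = 0])
    & (forall k t, edge D k t ->
         exists P : {vspace 'rV[R]_4},
           [/\ \dim P = 2,
               [/\ pt x k t \in P, pt x (k + 1) t \in P & Delta x k t \in P]
             & [/\ pt n k t \in P, pt n (k + 1) t \in P & Delta n k t \in P]])].

Definition circular_surface (D : set (int * R)) (x n : int -> R -> 'rV[R]_4) :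
    Prop :=
  [/\ unit_normal D x n, circularity D x
    & exists kappa kappa01 : int -> R -> R,
        (forall k t, D (k, t) -> pt n k t = - kappa k t *: pt x k t) /\
        (forall k t, edge D k t ->
           Delta n k t = - kappa01 k t *: Delta x k t)].

(** * Mixed area and curvatures *)

Definition wedge (a b : 'rV[R]_4) : 'rV[R]_4 -> 'rV[R]_4 :=
  fun c => lor a c *: b - lor b c *: a.

Definition mixed_area (x y : int -> R -> 'rV[R]_4) (k : int) (t : R) :
    'rV[R]_4 -> 'rV[R]_4 :=
  4^-1 *: (wedge (pt x k t + pt x (k + 1) t) (Delta y k t)
           + wedge (pt y k t + pt y (k + 1) t) (Delta x k t)).

(** The curvatures of [y] with normal [m] on the edge (k, t): the scalar solving
    the defining equation, which is unique when [mixed_area y y k t <> 0];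
    [curvatures_defined] says that both scalars do exist. *)

Definition gauss_curv (y m : int -> R -> 'rV[R]_4) (k : int) (t : R) : R :=
  xget 0 [set K : R | mixed_area m m k t = K *: mixed_area y y k t].

Definition mean_curv (y m : int -> R -> 'rV[R]_4) (k : int) (t : R) : R :=
  xget 0 [set H : R | mixed_area y m k t = - H *: mixed_area y y k t].

Definition curvatures_defined (y m : int -> R -> 'rV[R]_4) (k : int) (t : R) :
    Prop :=
  [/\ mixed_area y y k t <> 0,
      mixed_area m m k t = gauss_curv y m k t *: mixed_area y y k t
    & mixed_area y m k t = - mean_curv y m k t *: mixed_area y y k t].

(** * Parallel surfaces *)

Definition parallel_x (theta : R) (x n : int -> R -> 'rV[R]_4) :
    int -> R -> 'rV[R]_4 :=
  fun k t => cosh theta *: x k t + sinh theta *: n k t.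

Definition parallel_n (theta : R) (x n : int -> R -> 'rV[R]_4) :
    int -> R -> 'rV[R]_4 :=
  fun k t => sinh theta *: x k t + cosh theta *: n k t.

(** * Semi-discrete holomorphic functions and the Weierstrass representation *)

Definition sd_holomorphic (D : set (int * R)) (g : int -> R -> R[i])
    (sigma : int -> R) (tau : R -> R) : Prop :=
  [/\ sd_mapC D g,
      (forall k t, D (k, t) -> ptC g k t != 0)
    & (forall k t, edge D k t ->
         [/\ Delta g k t != 0,
             ptC g k t * ptC g (k + 1) t / Delta g k t ^+ 2
               = (tau t / sigma k)%:C
           & tau t / sigma k < 0])].

Definition calT (g : int -> R -> R[i]) (s : R) (k : int) (t : R) : R :=
  1 + s * ComplexField.Normc.normc (g k t) ^+ 2.

Definition weierstrass_data (D : set (int * R)) (g : int -> R -> R[i])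
    (sigma : int -> R) (tau : R -> R) (s lambda : R)
    (E : int -> R -> 'M[R[i]]_2) : Prop :=
  [/\ sd_holomorphic D g sigma tau,
      (forall k t, D (k, t) -> calT g s k t != 0),
      lambda != 0 /\ (forall k t, edge D k t -> 1 - lambda * sigma k != 0),
      [/\ sd_mapM D E,
          (forall k t, D (k, t) -> E k t \in unitmx)
        & (forall k t, D (k, t) -> complex.Im (\det (E k t)) = 0)]
    & (forall k t, edge D k t ->
         invmx (E k t) *m Delta E k t
           = mx2 0 (Delta g k t) ((lambda * sigma k)%:C / Delta g k t) 0) /\
      (forall k t, D (k, t) ->
         invmx (E k t) *m ptM E k t
           = mx2 0 (ptC g k t) ((lambda * tau t)%:C / ptC g k t) 0)].

Definition matL (g : int -> R -> R[i]) (s : R) (k : int) (t : R) :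
    'M[R[i]]_2 :=
  let r := sqrtC ((calT g s k t)%:C) in
  mx2 0 r (- 1 / r) (- (s%:C * conjc (g k t)) / r).

Definition weierstrass_x (g : int -> R -> R[i]) (s : R)
    (E : int -> R -> 'M[R[i]]_2) (k : int) (t : R) : 'M[R[i]]_2 :=
  let EL := E k t *m matL g s k t in
  ((Num.sg (calT g s k t))%:C / \det (E k t)) *:
    (EL *m (map_mx (@conjc R) EL)^T).

Definition weierstrass_n (g : int -> R -> R[i]) (s : R)
    (E : int -> R -> 'M[R[i]]_2) (k : int) (t : R) : 'M[R[i]]_2 :=
  let EL := E k t *m matL g s k t in
  ((Num.sg (calT g s k t))%:C / \det (E k t)) *:
    (EL *m mx2 1 0 0 (- 1) *m (map_mx (@conjc R) EL)^T).

(** The map [y] into Minkowski space is given over [D] by the field [W] of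
    (Hermitian) matrices. *)
Definition given_by (D : set (int * R)) (y : int -> R -> 'rV[R]_4)
    (W : int -> R -> 'M[R[i]]_2) : Prop :=
  forall k t, D (k, t) -> herm (y k t) = W k t.

Definition is_BrLW (D : set (int * R)) (x : int -> R -> 'rV[R]_4) : Prop :=
  exists g sigma tau s lambda E,
    weierstrass_data D g sigma tau s lambda E /\
    given_by D x (weierstrass_x g s E).

Definition is_BiLW (D : set (int * R)) (n : int -> R -> 'rV[R]_4) : Prop :=
  exists g sigma tau s lambda E,
    weierstrass_data D g sigma tau s lambda E /\
    given_by D n (weierstrass_n g s E).

End SemiDiscrete.

(* Main.v *)
Require Import Defs.
From mathcomp Require Import all_boot all_order all_algebra.
From mathcomp Require Import all_classical all_reals all_analysis.
From mathcomp Require Import complex.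
From mathcomp Require Import ring.

(** A parallel surface is again an edgewise scalar multiple of the original one:
    [d xt = (cosh theta - kappa sinh theta) d x] and likewise for [Delta], so
    circularity is inherited and, since the tangent plane has dimension two, all
    mixed areas of an edge are multiples of one bivector; the curvature formulas
    are then algebra.

    For Weierstrass data, [L diag(a, 1/a) = diag(1/a, a) L'] with
    [a = exp(theta/2)], where [L'] is the matrix of [g' = exp(theta) g] and
    [s' = exp(-2 theta) s].  Hence [x_theta] and [n_theta] are the surfaces of the
    data [(g', s', lambda, E diag(1/a, a))] and it suffices to treat [theta = 0].

    There, [x + n] and [x - n] are rank one: up to [2 / (T det E)] they are
    [e e^*] and [f f^*], where [e] is the second column of [E] and [f] is
    [secondary_spinor].  Both [d (x - n)] and [Delta (x - n)] are real multiples
    of [u = d (x + n)] and [v = Delta (x + n)], and [d (x + n)] at the next vertex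
    is [al u + be v] with [2 al (u o v) + be (v o v) = 0], which is circularity. *)

Set Implicit Arguments.
Unset Strict Implicit.
Unset Printing Implicit Defensive.

Import Order.TTheory GRing.Theory Num.Theory.
Import numFieldNormedType.Exports.

Local Open Scope classical_set_scope.
Local Open Scope ring_scope.

(** * Derivatives of complex-valued maps *)

Section ComplexDerivative.
Variable R : realType.
Local Open Scope complex_scope.
Implicit Types (f h : R -> R[i]) (t : R).

(** Differentiability and value in one relation, so that derivatives are built by rules and then
    adjusted with [is_deriveC_eq]. *)
Definition is_deriveC f t (d : R[i]) : Prop :=
  is_derive t 1 (fun u => complex.Re (f u) : R^o) (complex.Re d) /\
  is_derive t 1 (fun u => complex.Im (f u) : R^o) (complex.Im d).

Lemma ReM (z w : R[i]) : complex.Re (z * w) =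
  complex.Re z * complex.Re w - complex.Im z * complex.Im w.
Proof. by case: z w => [a b] [c d]. Qed.

Lemma ImM (z w : R[i]) : complex.Im (z * w) =
  complex.Re z * complex.Im w + complex.Im z * complex.Re w.
Proof. by case: z w => [a b] [c d]. Qed.

Lemma is_deriveC_unique f t d d' :
  is_deriveC f t d -> is_deriveC f t d' -> d = d'.
Proof.
case: d d' => [a b] [a' b'] [/= [_ <-] [_ <-]] [/= [_ <-] [_ <-]].
by [].
Qed.

Lemma is_deriveC_eq f t d d' : is_deriveC f t d -> d = d' -> is_deriveC f t d'.
Proof. by move=> ? <-. Qed.

Lemma near_eq_is_deriveC f h t d :
  (\near t, f t = h t) -> is_deriveC f t d -> is_deriveC h t d.
Proof.
by move=> fh [d1 d2]; split; [apply: near_eq_is_derive d1|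
  apply: near_eq_is_derive d2]; near=> u; congr (_ _); near: u.
Unshelve. all: by end_near. Qed.

Lemma is_deriveC_cst (c : R[i]) t : is_deriveC (fun=> c) t 0.
Proof. by split; exact: is_derive_cst. Qed.

Lemma is_deriveCD f h t d d' :
  is_deriveC f t d -> is_deriveC h t d' ->
  is_deriveC (fun u => f u + h u) t (d + d').
Proof.
move=> [f1 f2] [h1 h2]; split; rewrite raddfD /=.
- under eq_fun do rewrite raddfD; exact: is_deriveD.
- under eq_fun do rewrite raddfD; exact: is_deriveD.
Qed.

Lemma is_deriveCM f h t d d' :
  is_deriveC f t d -> is_deriveC h t d' ->
  is_deriveC (fun u => f u * h u) t (d * h t + f t * d').
Proof.
move=> [f1 f2] [h1 h2]; split; rewrite raddfD /= ?ReM ?ImM.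
- under eq_fun do rewrite ReM.
  by apply: is_derive_eq; rewrite /GRing.scale /=; ring.
- under eq_fun do rewrite ImM.
  by apply: is_derive_eq; rewrite /GRing.scale /=; ring.
Qed.

Lemma is_deriveC_conj f t d :
  is_deriveC f t d -> is_deriveC (fun u => conjc (f u)) t (conjc d).
Proof.
have Rec (z : R[i]) : complex.Re (conjc z) = complex.Re z by case: z.
have Imc (z : R[i]) : complex.Im (conjc z) = - complex.Im z by case: z.
move=> [f1 f2]; split; rewrite ?Rec ?Imc.
- by under eq_fun do rewrite Rec.
- by under eq_fun do rewrite Imc; exact: is_deriveN.
Qed.

Lemma is_deriveC_inv_real (h : R -> R) t (d : R) :
  h t != 0 -> is_derive t 1 (h : R -> R^o) d ->
  is_deriveC (fun u => ((h u)^-1)%:C) t (- (d / h t ^+ 2))%:C.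
Proof.
move=> h0 [dh <-]; split => /=; last exact: is_derive_cst.
apply: DeriveDef; first exact: derivableV.
by rewrite deriveV// /GRing.scale /= mulNr mulrC.
Qed.

(** Writing [1 / f] as the conjugate of [f] times the real function [1 / |f|^2] reduces the claim to
    the product rule and the inverse of a real function. *)
Lemma is_deriveC_inv f t d :
  f t != 0 -> is_deriveC f t d ->
  is_deriveC (fun u => (f u)^-1) t (- (d / f t ^+ 2)).
Proof.
move=> f0 df.
pose h u : R := complex.Re (f u * conjc (f u)).
have hE u : (h u)%:C = f u * conjc (f u).
  by rewrite /h; case: (f u) => a b; rewrite /=; congr Complex; ring.
have dff := is_deriveCM df (is_deriveC_conj df).
have cf0 : conjc (f t) != 0 by rewrite conjc_eq0.
have h0 : h t != 0.
  apply/eqP => h0; have := hE t; rewrite h0 => /esym/eqP.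
  by rewrite mulf_eq0 (negbTE f0) (negbTE cf0).
have dh : ((complex.Re (d * conjc (f t) + f t * conjc d))%:C : R[i]) =
    d * conjc (f t) + f t * conjc d.
  by case: (d) (f t) => [a b] [a' b']; rewrite /=; congr Complex; ring.
have dinv := is_deriveC_inv_real h0 dff.1.
have -> : (fun u => (f u)^-1) = (fun u => conjc (f u) * ((h u)^-1)%:C).
  apply/funext => u; rewrite fmorphV /= hE invfM.
  have [->|fu0] := eqVneq (f u) 0; first by rewrite invr0 mul0r mulr0.
  by rewrite mulrCA mulfV ?mulr1 // conjc_eq0.
have -> : - (d / f t ^+ 2) = conjc d * ((h t)^-1)%:C + conjc (f t) *
    (- (complex.Re (d * conjc (f t) + f t * conjc d) / h t ^+ 2))%:C.
  rewrite rmorphN rmorphM /= dh !fmorphV rmorphXn /= hE.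
  by field; rewrite f0 cf0.
exact: is_deriveCM (is_deriveC_conj df) dinv.
Qed.
End ComplexDerivative.

(** * Identities for an edge of a Weierstrass surface *)

Section WeierstrassAlgebra.
(* In the identities of this section a variable [gb], [dgb], [fb], ... stands for
   the complex conjugate of [g], [dg], [f], ..., and [(a, b)], [(c, e)] for the
   rows [i] of [E] and [j] of its conjugate; conjugates can be treated as
   independent variables. *)
Variable F : fieldType.

(** Here [T'], [f'], [fb'] come from the product rule and the equations [a' = l tau / dg * b],
    [b' = dg * a], with [d = det E] constant. The left sides are the derivatives of [b e / (T d)]
    and [f fb / (T d)]; the second is a multiple of the first. *)
Lemma tangent_ratio_F (a b c e g gb dg dgb s l tau d : F)
    (T := 1 + s * (g * gb)) :
  T != 0 -> d != 0 -> dg != 0 -> dgb != 0 ->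
  let f := T * a - s * gb * b in
  let fb := T * c - s * g * e in
  let T' := s * (dg * gb + g * dgb) in
  let f' := T' * a + T * (l * tau / dg * b) - s * (dgb * b + gb * (dg * a)) in
  let fb' := T' * c + T * (l * tau / dgb * e) - s * (dg * e + g * (dgb * c)) in
  let N' := (T ^+ 2 * d)^-1 * (dg * f * e + dgb * b * fb) in
  [/\ - (T' / T ^+ 2 / d) * (b * e) + (T * d)^-1 * (dg * a * e + b * (dgb * c))
        = N'
    & - (T' / T ^+ 2 / d) * (f * fb) + (T * d)^-1 * (f' * fb + f * fb')
        = (T ^+ 2 * l * tau / (dg * dgb) - s) * N'].
Proof.
rewrite {}/T => T0 d0 g0 gb0 /=.
by split; field; rewrite ?T0 ?d0 ?g0 ?gb0.
Qed.

(** The discrete counterpart of [tangent_ratio_F]: index [1] marks values at the next vertex, given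
    by the difference equation for [E]. The increment [V] is also expanded in the spinors [f], [b]
    of the first vertex, as [edge_circular_F] needs. *)
Lemma edge_ratio_F (a b c e g gb g1 g1b s l sg d : F)
    (T := 1 + s * (g * gb)) (T1 := 1 + s * (g1 * g1b)) :
  T != 0 -> T1 != 0 -> d != 0 -> 1 - l * sg != 0 -> g1 - g != 0 ->
  g1b - gb != 0 ->
  let a1 := a + l * sg / (g1 - g) * b in
  let b1 := b + (g1 - g) * a in
  let c1 := c + l * sg / (g1b - gb) * e in
  let e1 := e + (g1b - gb) * c in
  let d1 := d * (1 - l * sg) in
  let f := T * a - s * gb * b in
  let fb := T * c - s * g * e in
  let f1 := T1 * a1 - s * g1b * b1 in
  let fb1 := T1 * c1 - s * g1 * e1 in
  let q := (g1 - g) * (g1b - gb) in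
  let nu := T * T1 * l * sg / q - s in
  let V := (T1 * d1)^-1 * (b1 * e1) - (T * d)^-1 * (b * e) in
  let p := (g1 - g) * (1 + s * (g * g1b)) in
  let pb := (g1b - gb) * (1 + s * (gb * g1)) in
  [/\ V = (T ^+ 2 * T1 * d1)^-1 * (q * (f * fb) + p * f * e + pb * b * fb
            + nu * q * (b * e))
    & (T1 * d1)^-1 * (f1 * fb1) - (T * d)^-1 * (f * fb) = nu * V].
Proof.
rewrite {}/T {}/T1 => T0 T10 d0 l0 g0 gb0 /=.
by split; field; rewrite ?T0 ?T10 ?l0 ?d0 ?g0 ?gb0.
Qed.

(** Holomorphicity enters through [dg1 = rho * (g1 - g) ^+ 2 / dg]. It makes the derivative [U1] at
    the next vertex a combination of [U] and [V] whose coefficients do not depend on the spinor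
    entries. *)
Lemma edge_planar_F (a b c e g gb g1 g1b dg dgb s l sg rho d : F)
    (T := 1 + s * (g * gb)) (T1 := 1 + s * (g1 * g1b)) :
  T != 0 -> T1 != 0 -> d != 0 -> 1 - l * sg != 0 -> g1 - g != 0 ->
  g1b - gb != 0 -> dg != 0 -> dgb != 0 ->
  let a1 := a + l * sg / (g1 - g) * b in
  let b1 := b + (g1 - g) * a in
  let c1 := c + l * sg / (g1b - gb) * e in
  let e1 := e + (g1b - gb) * c in
  let d1 := d * (1 - l * sg) in
  let f := T * a - s * gb * b in
  let fb := T * c - s * g * e in
  let f1 := T1 * a1 - s * g1b * b1 in
  let fb1 := T1 * c1 - s * g1 * e1 in
  let q := (g1 - g) * (g1b - gb) in
  let p := (g1 - g) * (1 + s * (g * g1b)) in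
  let pb := (g1b - gb) * (1 + s * (gb * g1)) in
  let V := (T1 * d1)^-1 * (b1 * e1) - (T * d)^-1 * (b * e) in
  let U := (T ^+ 2 * d)^-1 * (dg * f * e + dgb * b * fb) in
  let dg1 := rho * (g1 - g) ^+ 2 / dg in
  let dg1b := rho * (g1b - gb) ^+ 2 / dgb in
  let U1 := (T1 ^+ 2 * d1)^-1 * (dg1 * f1 * e1 + dg1b * b1 * fb1) in
  U1 = - (rho * q * T / (T1 * (dg * dgb))) * U
       + rho * (dgb * p + dg * pb) / (T1 * (dg * dgb)) * V.
Proof.
rewrite {}/T {}/T1 => T0 T10 d0 l0 h0 hb0 g0 gb0 /=.
by field; rewrite ?T0 ?T10 ?l0 ?d0 ?g0 ?gb0 ?h0 ?hb0.
Qed.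

(** The two brackets are the polarised determinant of [U], [V] and the determinant of [V], that is
    [- 2 (u o v)] and [- (v o v)]. Since [U] and [V] are forms in the spinors of one vertex, their
    entries can stay independent variables. *)
Lemma edge_circular_F (f0 f1 b0 b1 fb0 fb1 e0 e1 : F)
    (g gb g1 g1b dg dgb s l sg rho d : F)
    (T := 1 + s * (g * gb)) (T1 := 1 + s * (g1 * g1b)) :
  T != 0 -> T1 != 0 -> d != 0 -> 1 - l * sg != 0 -> g1 - g != 0 ->
  g1b - gb != 0 -> dg != 0 -> dgb != 0 ->
  let q := (g1 - g) * (g1b - gb) in
  let p := (g1 - g) * (1 + s * (g * g1b)) in
  let pb := (g1b - gb) * (1 + s * (gb * g1)) in
  let nu := T * T1 * l * sg / q - s in
  let V f b fb e := (T ^+ 2 * T1 * (d * (1 - l * sg)))^-1 *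
    (q * (f * fb) + p * f * e + pb * b * fb + nu * q * (b * e)) in
  let U f b fb e := (T ^+ 2 * d)^-1 * (dg * f * e + dgb * b * fb) in
  let V00 := V f0 b0 fb0 e0 in let V01 := V f0 b0 fb1 e1 in
  let V10 := V f1 b1 fb0 e0 in let V11 := V f1 b1 fb1 e1 in
  let U00 := U f0 b0 fb0 e0 in let U01 := U f0 b0 fb1 e1 in
  let U10 := U f1 b1 fb0 e0 in let U11 := U f1 b1 fb1 e1 in
  - (rho * q * T / (T1 * (dg * dgb)))
    * (U00 * V11 + U11 * V00 - U01 * V10 - U10 * V01)
  + rho * (dgb * p + dg * pb) / (T1 * (dg * dgb)) * (V00 * V11 - V01 * V10)
  = 0.
Proof.
rewrite {}/T {}/T1 => T0 T10 d0 l0 h0 hb0 g0 gb0 /=.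
by field; rewrite ?T0 ?T10 ?l0 ?d0 ?g0 ?gb0 ?h0 ?hb0.
Qed.

(** With [dd], [dd1], [qq] for [|dg|^2], [|dg1|^2], [|Delta g|^2]: the terms in [l] cancel in pairs,
    and the remaining [- s] of each ratio add up to [- 2 s (1 + al)]. *)
Lemma weingarten_F (T T1 dd qq s l sg rho : F) :
  T1 != 0 -> dd != 0 -> qq != 0 -> rho != 0 ->
  let dd1 := rho ^+ 2 * qq ^+ 2 / dd in
  let mu := T ^+ 2 * l * (rho * sg) / dd - s in
  let mu1 := T1 ^+ 2 * l * (rho * sg) / dd1 - s in
  let nu := T * T1 * l * sg / qq - s in
  let al := - (rho * qq * T / (T1 * dd)) in
  (mu + al * mu1) + (1 + al) * nu + 2 * s * (1 + al) = 0.
Proof.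
move=> T0 d0 q0 r0 /=.
by field; rewrite ?T0 ?r0 ?d0 ?q0.
Qed.
End WeierstrassAlgebra.

(** * Two-by-two matrices by entries *)

Lemma ord4P (P : 'I_4 -> Prop) : P 0 -> P 1 -> P 2 -> P 3 -> forall j, P j.
Proof.
move=> P0 P1 P2 P3 [[|[|[|[|//]]]] i];
  [set o := 0 in P0|set o := 1 in P1|set o := 2 in P2|set o := 3 in P3];
  by rewrite (_ : Ordinal _ = o)//; exact: val_inj.
Qed.

Lemma ord2P (P : 'I_2 -> Prop) : P 0 -> P 1 -> forall j, P j.
Proof.
move=> P0 P1 [[|[|//]] i]; [set o := 0 in P0|set o := 1 in P1];
  by rewrite (_ : Ordinal _ = o)//; exact: val_inj.
Qed.

Lemma mx2P (T : Type) (M N : 'M[T]_2) : M 0 0 = N 0 0 -> M 0 1 = N 0 1 ->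
  M 1 0 = N 1 0 -> M 1 1 = N 1 1 -> M = N.
Proof. by move=> *; apply/matrixP; do 2 elim/ord2P. Qed.

Lemma mulmx2E (F : pzRingType) (M N : 'M[F]_2) i j :
  (M *m N) i j = M i 0 * N 0 j + M i 1 * N 1 j.
Proof.
rewrite mxE !big_ord_recl big_ord0 addr0.
by rewrite (_ : lift ord0 ord0 = 1)//; exact: val_inj.
Qed.

Lemma det2 (F : comNzRingType) (M : 'M[F]_2) :
  \det M = M 0 0 * M 1 1 - M 0 1 * M 1 0.
Proof.
have l1 : lift ord0 ord0 = 1 :> 'I_2 by exact: val_inj.
have l2 : lift 1 ord0 = 0 :> 'I_2 by exact: val_inj.
rewrite (expand_det_row _ 0) !big_ord_recl big_ord0 /cofactor !det_mx11 !mxE.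
by rewrite addr0 !l1 l2 /= expr0 expr1 mul1r mulN1r mulrN.
Qed.

Lemma invmx2 (F : fieldType) (M : 'M[F]_2) : \det M != 0 ->
  invmx M = (\det M)^-1 *: \matrix_(i, j)
    if i == 0 then (if j == 0 then M 1 1 else - M 0 1)
    else (if j == 0 then - M 1 0 else M 0 0).
Proof.
move=> M0; set N := _ *: _; suff NM : M *m N = 1%:M.
  by rewrite -[invmx M]mulmx1 -NM mulKmx// unitmxE unitfE.
move: M0; rewrite /N det2 => M0.
by apply: mx2P; rewrite mulmx2E !mxE /=; field.
Qed.

(* By Cayley-Hamilton [W := U *m invmx V] satisfies
   [W ^+ 2 = \tr W *: W - (\det W)%:M], so the coefficient of [V] is the one which cancels the trace term. *)
Lemma cross_ratio_planar_F (F : fieldType) (U V : 'M[F]_2) (a : F) :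
  \det V != 0 ->
  let tr := U 0 0 * V 1 1 + U 1 1 * V 0 0 - U 0 1 * V 1 0 - U 1 0 * V 0 1 in
  U *m invmx V *m (a *: U + - (a * tr / \det V) *: V) *m invmx V =
  (- (a * \det U / \det V))%:M.
Proof.
move=> V0 tr; rewrite invmx2//; move: V0; rewrite /tr !det2 => V0.
by apply: mx2P; rewrite !mulmx2E !mxE /= ?mulr1n ?mulr0n; field.
Qed.

(** * Minkowski space and Hermitian matrices *)

Section Minkowski.
Variable R : realType.
Local Open Scope complex_scope.
Implicit Types (z w u v : 'rV[R]_4).

Lemma herm00 z : herm z 0 0 = (z 0 3 + z 0 2)%:C. Proof. by rewrite mxE. Qed.
Lemma herm01 z : herm z 0 1 = z 0 0 -i* z 0 1. Proof. by rewrite mxE. Qed.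
Lemma herm10 z : herm z 1 0 = z 0 0 +i* z 0 1. Proof. by rewrite mxE. Qed.
Lemma herm11 z : herm z 1 1 = (z 0 3 - z 0 2)%:C. Proof. by rewrite mxE. Qed.
Definition hermE := (herm00, herm01, herm10, herm11).

Lemma hermD z w : herm (z + w) = herm z + herm w.
Proof.
by apply: mx2P; rewrite mxE ?hermE !mxE /=; congr Complex; ring.
Qed.

Lemma hermZ (a : R) z : herm (a *: z) = a%:C *: herm z.
Proof.
by apply: mx2P; rewrite mxE ?hermE !mxE /=; congr Complex; ring.
Qed.

Lemma hermN z : herm (- z) = - herm z.
Proof. by rewrite -scaleN1r hermZ rmorphN rmorph1 scaleN1r. Qed.

Lemma hermB z w : herm (z - w) = herm z - herm w.
Proof. by rewrite hermD hermN. Qed.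

Lemma herm_inj : injective (@herm R).
Proof.
move=> z w /matrixP zw; apply/rowP.
have := zw 0 0; have := zw 0 1; have := zw 1 1.
rewrite !hermE => -[h1] [h2 h3] [h4].
elim/ord4P => //; first exact: oppr_inj.
  by apply: (@mulfI _ 2) => //; transitivity
   ((z 0 3 + z 0 2) - (z 0 3 - z 0 2)); [ring|rewrite h1 h4; ring].
by apply: (@mulfI _ 2) => //; transitivity
   ((z 0 3 + z 0 2) + (z 0 3 - z 0 2)); [ring|rewrite h1 h4; ring].
Qed.

(** Polarisation of [z o z = - det z]; the right side is the trace term [tr] of
    [cross_ratio_planar_F]. *)
Lemma lor_herm u v : (- 2 * lor u v)%:C =
  herm u 0 0 * herm v 1 1 + herm u 1 1 * herm v 0 0
  - herm u 0 1 * herm v 1 0 - herm u 1 0 * herm v 0 1.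
Proof. by rewrite !hermE /lor /=; congr Complex; ring. Qed.

Lemma lor_herm_det v : (- lor v v)%:C =
  herm v 0 0 * herm v 1 1 - herm v 0 1 * herm v 1 0.
Proof. by rewrite !hermE /lor /=; congr Complex; ring. Qed.

Lemma det_herm v : \det (herm v) = (- lor v v)%:C.
Proof. by rewrite lor_herm_det det2. Qed.

Lemma herm_unit v : (herm v \in unitmx) = (lor v v != 0).
Proof.
by rewrite unitmxE det_herm unitfE -(rmorph0 (real_complex R))
  (inj_eq (@complexI _)) oppr_eq0.
Qed.

Lemma lorC u v : lor u v = lor v u.
Proof. by rewrite /lor; ring. Qed.
Lemma lorDl u v w : lor (u + v) w = lor u w + lor v w.
Proof. by rewrite /lor !mxE; ring. Qed.
Lemma lorZl (a : R) u w : lor (a *: u) w = a * lor u w.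
Proof. by rewrite /lor !mxE; ring. Qed.
Lemma lorDr u v w : lor w (u + v) = lor w u + lor w v.
Proof. by rewrite lorC lorDl !(lorC w). Qed.
Lemma lorZr (a : R) u w : lor w (a *: u) = a * lor w u.
Proof. by rewrite lorC lorZl (lorC w). Qed.

Lemma lor_lincomb (a b c d : R) u v w z :
  lor (a *: u + b *: v) (c *: w + d *: z) =
  a * c * lor u w + a * d * lor u z + b * c * lor v w + b * d * lor v z.
Proof. by rewrite lorDl !lorDr !lorZl !lorZr; ring. Qed.

(** The circularity condition of one edge in terms of its three vectors, which can then be rescaled
    independently. *)
Definition real_cross_ratio u u1 v : Prop := exists c : R,
  herm u *m invmx (herm v) *m herm u1 *m invmx (herm v) = (c%:C)%:M.

(** The cross ratio is multiplied by [a * a1 / b ^+ 2]. Invertibility of [b *: v] yields both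
    [b != 0] and invertibility of [v], so the scalars may vanish a priori. *)
Lemma real_cross_ratioZ (a a1 b : R) u u1 v :
  (herm v \in unitmx -> real_cross_ratio u u1 v) ->
  herm (b *: v) \in unitmx -> real_cross_ratio (a *: u) (a1 *: u1) (b *: v).
Proof.
move=> h bv; have := bv; rewrite herm_unit lorZl lorZr !mulf_eq0 !negb_or.
rewrite -herm_unit => /and3P[b0 _ /h[c hc]]; exists (a * a1 / b ^+ 2 * c).
rewrite !hermZ in bv *; rewrite invmxZ//.
rewrite -!(scalemxAl, scalemxAr) hc !scalerA scale_scalar_mx; congr _%:M.
rewrite -fmorphV -!rmorphM /=; congr (_ %:C).
by field.
Qed.

Lemma real_cross_ratio_planar (al be : R) u v :
  2 * al * lor u v + be * lor v v = 0 -> herm v \in unitmx ->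
  real_cross_ratio u (al *: u + be *: v) v.
Proof.

rewrite herm_unit => h v0.
have v0C : (- lor v v)%:C != 0 by rewrite fmorph_eq0 oppr_eq0.
(* This is [- al * det u / det v]; the hypothesis, solved for [be], gives exactly the coefficient of
   [V] in [cross_ratio_planar_F]. *)
exists (- al * lor u u / lor v v).
have be_eq : be%:C = - (al%:C * (- 2 * lor u v)%:C / (- lor v v)%:C).
  rewrite -fmorphV -!rmorphM -rmorphN /= -[be](mulfK v0).
  have -> : be * lor v v = - (2 * al * lor u v).
    by apply/eqP; rewrite -addr_eq0 addrC h.
  by congr _%:C; field.
have c_eq : (- al * lor u u / lor v v)%:C =
    - (al%:C * (- lor u u)%:C / (- lor v v)%:C).
  by rewrite -fmorphV -!rmorphM -rmorphN /=; congr _%:C; field.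
by rewrite {}c_eq hermD !hermZ be_eq lor_herm -!det_herm cross_ratio_planar_F
  ?det_herm.
Qed.

End Minkowski.

(** * Derivatives in Minkowski space *)

Section VectorDerivative.
Variable R : realType.
Local Open Scope complex_scope.

Lemma derive1_lincomb (V : normedModType R) (f h : R -> V) (a b t : R) :
  derivable f t 1 -> derivable h t 1 ->
  derivable (fun u => a *: f u + b *: h u) t 1 /\
  derive1 (fun u => a *: f u + b *: h u) t = a *: derive1 f t + b *: derive1 h t.
Proof.
move=> df dh; rewrite !derive1E.
have [] : is_derive t 1 ((a *: f) + (b *: h)) (a *: 'D_1 f t + b *: 'D_1 h t).
  by apply: is_deriveD; apply: is_deriveZ; exact/derivableP.
by [].
Qed.

Lemma smooth_on_lincomb (V : normedModType R) (U : set R) (f h : R -> V)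
    (a b : R) : open U -> smooth_on U f -> smooth_on U h ->
  smooth_on U (fun u => a *: f u + b *: h u).
Proof.
move=> oU sf sh m.
(* The induction uses the equality on a neighbourhood of each point, which is where openness of [U]
   enters. *)
have E : forall t, U t -> derive1n m (fun u => a *: f u + b *: h u) t =
    a *: derive1n m f t + b *: derive1n m h t.
  elim: m => [//|m IH] t Ut; rewrite !derive1nS.
  rewrite -(derive1_lincomb a b (sf m t Ut) (sh m t Ut)).2 !derive1E.
  apply: near_eq_derive; near=> u; apply: IH.
  by near: u; exact: open_nbhs_nbhs.
move=> t Ut.
apply: near_eq_derivable (derive1_lincomb a b (sf m t Ut) (sh m t Ut)).1.
by near=> u; rewrite E//; near: u; exact: open_nbhs_nbhs.
Unshelve. all: by end_near. Qed.

Lemma derive1_coord (y : R -> 'rV[R]_4) (t : R) j : derivable y t 1 ->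
  is_derive t 1 (fun u => y u 0 j : R^o) (derive1 y t 0 j).
Proof.
move=> dy; rewrite derive1E derive_mx// mxE; apply/derivableP.
by move/derivable_mxP : dy; exact.
Qed.

Lemma is_derive_lor (y z : R -> 'rV[R]_4) (t : R) :
  derivable y t 1 -> derivable z t 1 ->
  is_derive t 1 (fun u => lor (y u) (z u) : R^o)
    (lor (derive1 y t) (z t) + lor (y t) (derive1 z t)).
Proof.
move=> dy dz; have Dy j := derive1_coord j dy; have Dz j := derive1_coord j dz.
by apply: is_derive_eq; rewrite /lor /GRing.scale /=; ring.
Qed.

Lemma lor_derive_cst (y z : R -> 'rV[R]_4) (t c : R) :
  derivable y t 1 -> derivable z t 1 ->
  (\near t, lor (y t) (z t) = c) ->
  lor (derive1 y t) (z t) + lor (y t) (derive1 z t) = 0.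
Proof.
move=> dy dz yz; have [_ <-] := is_derive_lor dy dz.
by rewrite (near_eq_derive _ (g := cst c))// derive_cst.
Qed.

Lemma is_deriveC_herm (y : R -> 'rV[R]_4) (t : R) i j : derivable y t 1 ->
  is_deriveC (fun u => herm (y u) i j) t (herm (derive1 y t) i j).
Proof.
move=> dy; have Dy j' := derive1_coord j' dy.
elim/ord2P: i; elim/ord2P: j; rewrite hermE; under eq_fun do rewrite hermE;
  split => /=; by [apply: is_derive_eq|exact: is_derive_cst].
Qed.

(** Differentiability of [y] is a conclusion: a Weierstrass surface is known only through its
    matrices, and its coordinates are real-linear in the real and imaginary parts of their
    entries. *)
Lemma herm_derive (y : R -> 'rV[R]_4) (t : R) (W : R -> 'M[R[i]]_2)
    (W' : 'M[R[i]]_2) :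
  (\near t, herm (y t) = W t) ->
  (forall i j, is_deriveC (fun u => W u i j) t (W' i j)) ->
  derivable y t 1 /\ herm (derive1 y t) = W'.
Proof.
move=> yW dW.
have dH i j : is_deriveC (fun u => herm (y u) i j) t (W' i j).
  apply: near_eq_is_deriveC (dW i j).
  by near=> u; congr (fun_of_matrix _ i j); apply/esym; near: u.
have dy : derivable y t 1.
  have d2 : (fun u => y u 0 2) = (fun u => 2^-1 * complex.Re (herm (y u) 0 0)
    - 2^-1 * complex.Re (herm (y u) 1 1)).
    by apply/funext => u; rewrite !hermE /=; field.
  have d3 : (fun u => y u 0 3) = (fun u => 2^-1 * complex.Re (herm (y u) 0 0)
    + 2^-1 * complex.Re (herm (y u) 1 1)).
    by apply/funext => u; rewrite !hermE /=; field.
  have [h1 _] := dH 0 0; have [h2 _] := dH 1 1; have [h3 h4] := dH 1 0.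
  have eq10 u : herm (y u) 1 0 = y u 0 0 +i* y u 0 1 by rewrite hermE.
  apply/derivable_mxP => i j; rewrite ord1 {i}; elim/ord4P: j.
  - by case: h3 => + _; under eq_fun do rewrite eq10.
  - by case: h4 => + _; under eq_fun do rewrite eq10.
  - by rewrite d2; apply: derivableB; apply: derivableZ; [case: h1|case: h2].
  - by rewrite d3; apply: derivableD; apply: derivableZ; [case: h1|case: h2].
split => //; apply/matrixP => i j.
exact: is_deriveC_unique (is_deriveC_herm i j dy) (dH i j).
Unshelve. all: by end_near. Qed.
End VectorDerivative.

(** * Mixed area *)

Section MixedArea.
Variable R : realType.
Implicit Types (u v w : 'rV[R]_4) (x y m : int -> R -> 'rV[R]_4).

Lemma wedgeDZl (a b : R) u v w :
  wedge (a *: u + b *: v) w = a *: wedge u w + b *: wedge v w.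
Proof.
apply/funext => c; apply/rowP => j.
rewrite /wedge /= lorDl !lorZl ![in RHS]/GRing.add ![in RHS]/GRing.scale /= !mxE.
by ring.
Qed.

Lemma wedgevv v : wedge v v = 0.
Proof. by apply/funext => c; rewrite /wedge subrr. Qed.

Lemma wedgeZr (a : R) u v : wedge u (a *: v) = a *: wedge u v.
Proof.
apply/funext => c; apply/rowP => j.
by rewrite /wedge lorZl [in RHS]/GRing.scale /= !mxE; ring.
Qed.

(** Both difference vectors are multiples of [v] and [wedge v v = 0], so the components [a'], [c']
    along [v] drop out. *)
Lemma mixed_area_frame y m k t u v (a a' b c c' d : R) :
  pt y k t + pt y (k + 1) t = a *: u + a' *: v -> Delta y k t = b *: v ->
  pt m k t + pt m (k + 1) t = c *: u + c' *: v -> Delta m k t = d *: v ->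
  mixed_area y m k t = ((a * d + c * b) / 4) *: wedge u v.
Proof.
move=> h1 h2 h3 h4; rewrite /mixed_area h1 h2 h3 h4 !wedgeZr !wedgeDZl wedgevv.
by rewrite !scaler0 !addr0 !scalerA -scalerDl scalerA; congr (_ *: _); ring.
Qed.

(** All mixed areas are multiples of the nonzero bivector [wedge u v], so the defining equations of
    the curvatures become scalar equations with a unique solution. *)
Lemma curvature_frame y m k t u v (a a' b c c' d : R) :
  pt y k t + pt y (k + 1) t = a *: u + a' *: v -> Delta y k t = b *: v ->
  pt m k t + pt m (k + 1) t = c *: u + c' *: v -> Delta m k t = d *: v ->
  mixed_area y y k t <> 0 ->
  [/\ a * b != 0, curvatures_defined y m k t,
      gauss_curv y m k t = c * d / (a * b)
    & mean_curv y m k t = - (a * d + c * b) / (2 * (a * b))].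
Proof.
move=> h1 h2 h3 h4.
have Ayy := mixed_area_frame h1 h2 h1 h2.
have Amm := mixed_area_frame h3 h4 h3 h4.
have Aym := mixed_area_frame h1 h2 h3 h4.
move=> /[dup] A0 /eqP; rewrite Ayy scaler_eq0 negb_or => /andP[ab0 W0].
have ab : a * b != 0.
  by apply: contraNneq ab0 => ->; rewrite addr0 mul0r.
have [a0 b0] : a != 0 /\ b != 0 by apply/andP; rewrite -negb_or -mulf_eq0.
have inj (p q : R) : p *: wedge u v = q *: wedge u v -> p = q.
  move=> /eqP; rewrite -subr_eq0 -scalerBl scaler_eq0 (negbTE W0) orbF.
  by rewrite subr_eq0 => /eqP.
have KE : mixed_area m m k t = (c * d / (a * b)) *: mixed_area y y k t.
  by rewrite Amm Ayy scalerA; congr (_ *: _); field; rewrite a0 b0.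
have HE : mixed_area y m k t =
    - (- (a * d + c * b) / (2 * (a * b))) *: mixed_area y y k t.
  by rewrite Aym Ayy scalerA; congr (_ *: _); field; rewrite a0 b0.
have injA (p q : R) :
    p *: mixed_area y y k t = q *: mixed_area y y k t -> p = q.
  by rewrite Ayy !scalerA => /inj /(mulIf ab0).
have gE : gauss_curv y m k t = c * d / (a * b).
  by apply: xget_unique => // K /=; rewrite KE => /injA.
have mE : mean_curv y m k t = - (a * d + c * b) / (2 * (a * b)).
  by apply: xget_unique => // H /=; rewrite HE => /injA /oppr_inj.
by split => //; split; rewrite ?gE ?mE.
Qed.

(** A nonzero bivector makes [u], [v] independent, and two independent vectors span a space of
    dimension two. *)
Lemma plane_span (P : {vspace 'rV[R]_4}) u v w : \dim P = 2%N ->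
  u \in P -> v \in P -> w \in P -> wedge u v <> 0 ->
  exists a b : R, w = a *: u + b *: v.
Proof.
move=> dP uP vP wP uv.
have fr : free [:: u; v].
  rewrite free_cons seq1_free span_seq1; apply/andP; split.
    apply/negP => /vlineP[c uE]; apply: uv.
    by have := wedgeDZl c 0 v v v; rewrite scale0r addr0 wedgevv !scaler0 addr0 uE.
  by apply/eqP => v0; apply: uv; rewrite v0 -(scale0r 0) wedgeZr scale0r.
have PE : (<<[:: u; v]>> = P)%VS.
  apply/eqP; rewrite eqEdim dP (eqP fr) /= leqnn andbT.
  by apply/span_subvP => z; rewrite !inE => /orP[] /eqP ->.
move: wP; rewrite -PE span_cons span_seq1 => /memv_addP[w1 /vlineP[a ->]].
by move=> [w2 /vlineP[b ->] ->]; exists a, b.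
Qed.
End MixedArea.

(** * Parallel surfaces of a circular surface *)

Section ParallelSurface.
Variable R : realType.
Implicit Types (theta : R).

Lemma cosh_sinh theta : cosh theta ^+ 2 = 1 + sinh theta ^+ 2.
Proof.
by rewrite /cosh /sinh expRN; field; rewrite expR_eq0.
Qed.

Lemma cosh_double theta : cosh (2 * theta) = cosh theta ^+ 2 + sinh theta ^+ 2.
Proof.
rewrite /cosh /sinh !expRN mulr_natl mulr2n expRD.
by field; rewrite expR_eq0.
Qed.

Lemma sinh_double theta : sinh (2 * theta) = 2 * (sinh theta * cosh theta).
Proof.
rewrite /cosh /sinh !expRN mulr_natl mulr2n expRD.
by field; rewrite expR_eq0.
Qed.

Lemma pt_lincomb (x n : int -> R -> 'rV[R]_4) (a b : R) k t :
  derivable (x k) t 1 -> derivable (n k) t 1 ->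
  pt (fun k t => a *: x k t + b *: n k t) k t =
  a *: (pt x k t : 'rV[R]_4) + b *: (pt n k t : 'rV[R]_4) :> 'rV[R]_4.
Proof. by move=> dx dn; rewrite /pt (derive1_lincomb a b dx dn).2. Qed.

Lemma Delta_lincomb (x n : int -> R -> 'rV[R]_4) (a b : R) k t :
  Delta (fun k t => a *: x k t + b *: n k t) k t =
  a *: (Delta x k t : 'rV[R]_4) + b *: (Delta n k t : 'rV[R]_4) :> 'rV[R]_4.
Proof.
by rewrite /Delta !scalerBr opprD addrACA.
Qed.

Lemma memv_lincomb (P : {vspace 'rV[R]_4}) (u v : 'rV[R]_4) (a b : R) :
  u \in P -> v \in P -> a *: u + b *: v \in P.
Proof. by move=> uP vP; rewrite memvD ?memvZ. Qed.


Lemma lincomb_frame (V : lmodType R) (x0 x1 n0 n1 u v : V) (a b al be : R) :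
  x0 + x1 = u -> n0 + n1 = al *: u + be *: v ->
  (a *: x0 + b *: n0) + (a *: x1 + b *: n1) =
  (a + b * al) *: u + (b * be) *: v.
Proof.
move=> xu nu; rewrite addrACA -!scalerDr nu xu scalerDr !scalerA addrA.
by rewrite -scalerDl.
Qed.

Variables (D : set (int * R)) (hD : sd_domain D).
Variables (x n : int -> R -> 'rV[R]_4).

Lemma parallel_unit_normal theta : unit_normal D x n ->
  unit_normal D (parallel_x theta x n) (parallel_n theta x n).
Proof.
move=> [sx sn pw pl].
have dx k t : D (k, t) -> derivable (x k) t 1 by move=> Dkt; exact: (sx k 0%N).
have dn k t : D (k, t) -> derivable (n k) t 1 by move=> Dkt; exact: (sn k 0%N).
have ptE a b k t : D (k, t) ->
    pt (fun k t => a *: x k t + b *: n k t) k t =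
    a *: (pt x k t : 'rV[R]_4) + b *: (pt n k t : 'rV[R]_4) :> 'rV[R]_4.
  by move=> Dkt; apply: pt_lincomb; auto.
split.
- by move=> k; apply: smooth_on_lincomb.
- by move=> k; apply: smooth_on_lincomb.
- move=> k t Dkt; have [xx nn xn ndx] := pw k t Dkt.
  have nearD : \forall u \near t, D (k, u).
    by apply: open_nbhs_nbhs; split=> //; exact: hD.
  (* Differentiating [x o x = -1], [n o n = 1] and [x o n = 0] gives [x o dx = 0], [n o dn = 0] and,
     with [n o dx = 0], also [x o dn = 0]. *)
  have h1 : lor (pt x k t) (x k t) + lor (x k t) (pt x k t) = 0.
    by apply: (lor_derive_cst (c := -1)); [auto|auto|apply: filterS nearD => u;
      case/pw].
  have h2 : lor (pt n k t) (n k t) + lor (n k t) (pt n k t) = 0.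
    by apply: (lor_derive_cst (c := 1)); [auto|auto|apply: filterS nearD => u;
      case/pw].
  have h3 : lor (pt x k t) (n k t) + lor (x k t) (pt n k t) = 0.
    by apply: (lor_derive_cst (c := 0)); [auto|auto|apply: filterS nearD => u;
      case/pw].
  rewrite [pt (parallel_x _ _ _) k t]ptE// /parallel_x /parallel_n.
  have chsh := cosh_sinh theta.
  rewrite (lorC (pt x k t) (n k t)) ndx add0r in h3.
  rewrite (lorC (pt x k t)) -mulr2n in h1; rewrite (lorC (pt n k t)) -mulr2n in h2.
  move/eqP: h1; rewrite mulrn_eq0 /= => /eqP h1.
  move/eqP: h2; rewrite mulrn_eq0 /= => /eqP h2.
  rewrite !lor_lincomb (lorC (n k t) (x k t)) xx nn xn h1 h2 h3 ndx.
  by split; ring: chsh.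
- move=> k t [Dkt Dkt1]; have [P [dP [P1 P2 P3] [P4 P5 P6]]] := pl k t (conj Dkt Dkt1).
  exists P; rewrite /parallel_x /parallel_n !Delta_lincomb !ptE//.
  split => //; split; [exact: memv_lincomb P1 P4|exact: memv_lincomb P2 P5
    |exact: memv_lincomb P3 P6|exact: memv_lincomb P1 P4
    |exact: memv_lincomb P2 P5|exact: memv_lincomb P3 P6].
Qed.

(** In the frame [u], [v] of [x], the normal [n] has coefficients [al], [ga], so [K0 = al * ga] and
    [H0 = - (al + ga) / 2]. The coefficients of the parallel pair are [cosh + sinh * al],
    [cosh + sinh * ga] and the same with [cosh] and [sinh] exchanged; [denom] is the product of the
    first two. *)
Lemma parallel_curvature theta k t :
  circular_surface D x n -> edge D k t ->
  let xt := parallel_x theta x n in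
  let nt := parallel_n theta x n in
  mixed_area x x k t <> 0 -> mixed_area xt xt k t <> 0 ->
  let K0 := gauss_curv x n k t in
  let H0 := mean_curv x n k t in
  let denom := cosh theta ^+ 2 - H0 * sinh (2 * theta)
               + K0 * sinh theta ^+ 2 in
  [/\ curvatures_defined x n k t,
      curvatures_defined xt nt k t,
      gauss_curv xt nt k t
        = (K0 * cosh theta ^+ 2 - H0 * sinh (2 * theta)
           + sinh theta ^+ 2) / denom
    & mean_curv xt nt k t
        = (- (K0 + 1) * sinh (2 * theta)
           + 2 * H0 * cosh (2 * theta)) / (2 * denom)].
Proof.
move=> [[sx sn _ pl] _ [_ [ka [_ dn]]]] [Dkt Dkt1] xt nt A0 At0.
set u := pt x k t + pt x (k + 1) t; set v := Delta x k t.
have [P [dP [P1 P2 P3] [P4 P5 P6]]] := pl k t (conj Dkt Dkt1).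
have ux : pt x k t + pt x (k + 1) t = 1 *: u + 0 *: v.
  by rewrite scale1r scale0r addr0.
have vx : Delta x k t = 1 *: v by rewrite scale1r.
have Axx := mixed_area_frame ux vx ux vx.
(* Nonzero mixed area of [x] forces the frame to be independent, so the tangent plane of the edge is
   its span. *)
have uv : wedge u v <> 0 by move=> uv0; apply: A0; rewrite Axx uv0 scaler0.
have [al [be un]] : exists a b : R, pt n k t + pt n (k + 1) t = a *: u + b *: v.
  exact: (plane_span dP (memvD P1 P2) P3 (memvD P4 P5) uv).
have vn := dn k t (conj Dkt Dkt1); set ga := - _ in vn.
have ptE a b k' : D (k', t) ->
    pt (fun k t => a *: x k t + b *: n k t) k' t =
    a *: (pt x k' t : 'rV[R]_4) + b *: (pt n k' t : 'rV[R]_4) :> 'rV[R]_4.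
  by move=> Dk; apply: pt_lincomb; [exact: (sx k' 0%N)|exact: (sn k' 0%N)].
have uE a b : pt (fun k t => a *: x k t + b *: n k t) k t +
    pt (fun k t => a *: x k t + b *: n k t) (k + 1) t =
    (a + b * al) *: u + (b * be) *: v.
  rewrite (ptE a b k Dkt) (ptE a b (k + 1) Dkt1).
  exact: lincomb_frame (erefl u) un.
have vE a b : Delta (fun k t => a *: x k t + b *: n k t) k t = (a + b * ga) *: v.
  by rewrite Delta_lincomb vn scalerA -scalerDl.
have [_ Cx Kx Hx] := curvature_frame ux vx un vn A0.
have [ab0 Ct Kt Ht] := curvature_frame (uE (cosh theta) (sinh theta))
  (vE (cosh theta) (sinh theta)) (uE (sinh theta) (cosh theta))
  (vE (sinh theta) (cosh theta)) At0.
have K0 : gauss_curv x n k t = al * ga by rewrite Kx mulr1 divr1.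
have H0 : mean_curv x n k t = - (ga + al) / 2 by rewrite Hx !mulr1 mul1r.
rewrite K0 H0 cosh_double sinh_double; split => //.
- by rewrite [LHS]Kt; congr (_ / _); field.
- by rewrite [LHS]Ht; congr (_ / _); field.
Qed.

(** General coefficients serve both [x_theta] and [n_theta]: the principal curvature equations turn
    each edge vector into a multiple of that of [x]. *)
Lemma parallel_circularity (a b : R) : circular_surface D x n ->
  circularity D (fun k t => a *: x k t + b *: n k t).
Proof.
move=> [[sx sn _ _] cx [ka [ka01 [ptn dn]]]] k t ekt.
have [Dkt Dkt1] := ekt.
have ptE k' : D (k', t) -> pt (fun k t => a *: x k t + b *: n k t) k' t =
    (a - b * ka k' t) *: pt x k' t.
  move=> Dk; rewrite pt_lincomb; [|exact: (sx k' 0%N)|exact: (sn k' 0%N)].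
  by rewrite ptn// scalerA -scalerDl mulrN.
rewrite /tangent_cross_ratio (ptE k Dkt) (ptE (k + 1) Dkt1).
rewrite Delta_lincomb (dn k t ekt) scalerA -scalerDl.
exact: (real_cross_ratioZ _ _ (cx k t ekt)).
Qed.

End ParallelSurface.

(** * The Weierstrass-type representation *)

Section WeierstrassVertex.
Variable R : realType.
Local Open Scope complex_scope.

(** The squared modulus as a real polynomial, free of square roots. *)
Definition sqn (z : R[i]) : R := complex.Re z ^+ 2 + complex.Im z ^+ 2.

Lemma sqnE z : (sqn z)%:C = z * conjc z.
Proof. by case: z => a b; rewrite /sqn /=; congr Complex; ring. Qed.

Lemma sqn_eq0 z : (sqn z == 0) = (z == 0).
Proof.
by rewrite -(fmorph_eq0 (real_complex R)) /= sqnE mulf_eq0 conjc_eq0 orbb.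
Qed.

Lemma calT_sqn (g : int -> R -> R[i]) s k t :
  calT g s k t = 1 + s * sqn (g k t).
Proof.
rewrite /calT /ComplexField.Normc.normc /sqn; case: (g k t) => a b /=.
by rewrite sqr_sqrtr// addr_ge0// sqr_ge0.
Qed.

Lemma calTC (g : int -> R -> R[i]) s k t :
  (calT g s k t)%:C = 1 + s%:C * (g k t * conjc (g k t)).
Proof. by rewrite calT_sqn rmorphD rmorphM rmorph1 /= sqnE. Qed.

(** The squared modulus of [sqrtC a] is [|a|], also for negative [a]; the sign factor of the
    representation thus turns [1 / |T|] into [1 / T]. *)
Lemma sqrtC_calT (a : R) : a != 0 ->
  (Num.sg a)%:C / (sqrtC a%:C * conjc (sqrtC a%:C)) = a%:C^-1.
Proof.
move=> a0; rewrite -sqr_normc -normrX sqrtCK.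
case: (ltrgtP a 0) => [an|ap|/eqP]; last by rewrite (negbTE a0).
- by rewrite ltr0_sg// ltr0_norm ?ltcR// rmorphN rmorph1 invrN mulN1r opprK.
- by rewrite gtr0_sg// gtr0_norm ?ltcR// rmorph1 mul1r.
Qed.

Variables (g : int -> R -> R[i]) (s : R) (E : int -> R -> 'M[R[i]]_2).

(* The second column of [E k t *m matL g s k t] times [sqrtC (calT g s k t)];
   the first one is [- E k t _ 1], up to the same factor. *)
Definition secondary_spinor (k : int) (t : R) (i : 'I_2) : R[i] :=
  (1 + s%:C * (g k t * conjc (g k t))) * E k t i 0
  - s%:C * conjc (g k t) * E k t i 1.

(** The entries of [(x + n) / 2], and below those of [(x - n) / 2]. [calT] is expanded as a
    polynomial in [g] and its conjugate to match the field identities. *)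
Definition spinor_sum (k : int) (t : R) (i j : 'I_2) : R[i] :=
  ((1 + s%:C * (g k t * conjc (g k t))) * \det (E k t))^-1 *
  (E k t i 1 * conjc (E k t j 1)).

Definition spinor_diff (k : int) (t : R) (i j : 'I_2) : R[i] :=
  ((1 + s%:C * (g k t * conjc (g k t))) * \det (E k t))^-1 *
  (secondary_spinor k t i * conjc (secondary_spinor k t j)).

(** Both surfaces combine the rank one matrices of the two columns of [EL]; the factor [diag(1, -1)]
    only flips the sign of the second one. *)
Lemma weierstrassE k t i j : calT g s k t != 0 ->
  weierstrass_x g s E k t i j = spinor_sum k t i j + spinor_diff k t i j /\
  weierstrass_n g s E k t i j = spinor_sum k t i j - spinor_diff k t i j.
Proof.
move=> T0; rewrite /weierstrass_x /weierstrass_n /matL.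
set r := sqrtC _; set EL := E k t *m mx2 0 r _ _.
have r2 : r ^+ 2 = (calT g s k t)%:C by rewrite sqrtCK.
have r0 : r != 0 by rewrite sqrtC_eq0 fmorph_eq0.
have rb0 : conjc r != 0 by rewrite conjc_eq0.
have sgE := sqrtC_calT T0; rewrite -/r in sgE.
have EL0 l : EL l 0 = - E k t l 1 / r by rewrite mulmx2E !mxE /=; field.
have EL1 l : EL l 1 = secondary_spinor k t l / r.
  by rewrite mulmx2E !mxE /= /secondary_spinor -calTC -r2; field.
clearbody EL.
have N : spinor_sum k t i j = (Num.sg (calT g s k t))%:C / \det (E k t) *
    (EL i 0 * conjc (EL j 0)).
  rewrite /spinor_sum -calTC invfM -sgE !EL0 rmorphM rmorphN fmorphV /=.
  by rewrite mulrACA -!mulrA; congr (_ * _); rewrite invfM; ring.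
have Q : spinor_diff k t i j = (Num.sg (calT g s k t))%:C / \det (E k t) *
    (EL i 1 * conjc (EL j 1)).
  rewrite /spinor_diff -calTC invfM -sgE !EL1 rmorphM fmorphV /=.
  by rewrite -!mulrA; congr (_ * _); rewrite invfM; ring.
have X : (EL *m (map_mx (@conjc R) EL)^T) i j =
    EL i 0 * conjc (EL j 0) + EL i 1 * conjc (EL j 1).
  by rewrite mulmx2E ![_^T _ _]mxE ![map_mx _ _ _ _]mxE.
have Y : (EL *m mx2 1 0 0 (- 1) *m (map_mx (@conjc R) EL)^T) i j =
    EL i 0 * conjc (EL j 0) - EL i 1 * conjc (EL j 1).
  rewrite !mulmx2E ![_^T _ _]mxE ![map_mx _ _ _ _]mxE ![mx2 _ _ _ _ _ _]mxE /=.
  by ring.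
by rewrite N Q; split; rewrite mxE ?X ?Y; ring.
Qed.

End WeierstrassVertex.

(** * The frame equations and the derivatives of the spinor matrices *)

Section WeierstrassEdge.
Variable R : realType.
Local Open Scope complex_scope.
Variables (D : set (int * R)) (hD : sd_domain D).

Lemma conjcM (z w : R[i]) : conjc (z * w) = conjc z * conjc w.
Proof. exact: rmorphM. Qed.

Lemma sd_mapC_derive (f : int -> R -> R[i]) k t : sd_mapC D f -> D (k, t) ->
  is_deriveC (f k) t (ptC f k t).
Proof.
move=> [fr fi] Dkt; split; rewrite /= /pt derive1E; apply/derivableP.
  exact: (fr k 0%N t Dkt).
exact: (fi k 0%N t Dkt).
Qed.

Variables (g : int -> R -> R[i]) (sigma : int -> R) (tau : R -> R).
Variables (s lambda : R) (E : int -> R -> 'M[R[i]]_2).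
Hypothesis hW : weierstrass_data D g sigma tau s lambda E.

Lemma ptM_col k t i : D (k, t) ->
  ptM E k t i 0 = (lambda * tau t)%:C / ptC g k t * E k t i 1 /\
  ptM E k t i 1 = ptC g k t * E k t i 0.
Proof.
move=> Dkt; have [_ _ _ [_ Eu _] [_ hE]] := hW.
have -> : ptM E k t = E k t *m mx2 0 (ptC g k t)
    ((lambda * tau t)%:C / ptC g k t) 0.
  by rewrite -hE// mulKVmx// Eu.
by rewrite !mulmx2E ![mx2 _ _ _ _ _ _]mxE /=; split; ring.
Qed.

Lemma Delta_col k t i : edge D k t ->
  E (k + 1) t i 0 =
    E k t i 0 + (lambda * sigma k)%:C / Delta g k t * E k t i 1 /\
  E (k + 1) t i 1 = E k t i 1 + Delta g k t * E k t i 0.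
Proof.
move=> ekt; have [_ _ _ [_ Eu _] [hE _]] := hW.
have -> : E (k + 1) t = E k t + Delta E k t by rewrite /Delta addrCA subrr addr0.
have -> : Delta E k t = E k t *m mx2 0 (Delta g k t)
    ((lambda * sigma k)%:C / Delta g k t) 0.
  by rewrite -hE// mulKVmx// Eu//; case: ekt.
by rewrite ![fun_of_matrix (_ + _) _ _]mxE !mulmx2E ![mx2 _ _ _ _ _ _]mxE /=; split; ring.
Qed.

Lemma det_neq0 k t : D (k, t) -> \det (E k t) != 0.
Proof.
by move=> Dkt; have [_ _ _ [_ Eu _] _] := hW; rewrite -unitfE -unitmxE Eu.
Qed.

Lemma ptC_neq0 k t : D (k, t) -> ptC g k t != 0.
Proof. by have [[_ + _] _ _ _ _] := hW; exact. Qed.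

Lemma calTC_neq0 k t : D (k, t) ->
  1 + s%:C * (g k t * conjc (g k t)) != 0.
Proof.
by move=> Dkt; have [_ T0 _ _ _] := hW; rewrite -calTC fmorph_eq0 T0.
Qed.

(** The real factor [mu] with [d (x - n) = mu d (x + n)], read off from [tangent_ratio_F]. *)
Definition tangent_ratio k t : R :=
  calT g s k t ^+ 2 * lambda * tau t / sqn (ptC g k t) - s.

Definition pt_spinor_sum k t (i j : 'I_2) : R[i] :=
  ((1 + s%:C * (g k t * conjc (g k t))) ^+ 2 * \det (E k t))^-1 *
  (ptC g k t * secondary_spinor g s E k t i * conjc (E k t j 1)
   + conjc (ptC g k t) * E k t i 1 * conjc (secondary_spinor g s E k t j)).

Lemma conj_secondary_spinor k t i : conjc (secondary_spinor g s E k t i) =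
  (1 + s%:C * (g k t * conjc (g k t))) * conjc (E k t i 0)
  - s%:C * g k t * conjc (E k t i 1).
Proof.
rewrite /secondary_spinor; move: (s%:C) (conjc_real s) => S cS.
rewrite rmorphB !rmorphM rmorphD rmorph1 !rmorphM /= conjcK cS.
by rewrite (mulrC (conjc (g k t))).
Qed.

Lemma spinor_derive k t i j : D (k, t) ->
  is_deriveC (fun u => spinor_sum g s E k u i j) t (pt_spinor_sum k t i j) /\
  is_deriveC (fun u => spinor_diff g s E k u i j) t
    ((tangent_ratio k t)%:C * pt_spinor_sum k t i j).
Proof.
move=> Dkt; have [[gs _ _] _ _ [Es _ _] _] := hW.
have Dg := sd_mapC_derive gs Dkt.
have DE0 l : is_deriveC (fun u => E k u l 0) t
    ((lambda * tau t)%:C / ptC g k t * E k t l 1).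
  by have := sd_mapC_derive (Es l 0) Dkt; rewrite -(ptM_col l Dkt).1 mxE.
have DE1 l : is_deriveC (fun u => E k u l 1) t (ptC g k t * E k t l 0).
  by have := sd_mapC_derive (Es l 1) Dkt; rewrite -(ptM_col l Dkt).2 mxE.
have T0 := calTC_neq0 Dkt; have d0 := det_neq0 Dkt; have g0 := ptC_neq0 Dkt.
have gb0 : conjc (ptC g k t) != 0 by rewrite conjc_eq0.
have DT := is_deriveCD (is_deriveC_cst 1 t)
  (is_deriveCM (is_deriveC_cst s%:C t) (is_deriveCM Dg (is_deriveC_conj Dg))).
(* The determinant is constant in [t] because the matrix of the differential equation has trace
   zero. *)
have Ddet : is_deriveC (fun u => \det (E k u)) t 0.
  under eq_fun do rewrite det2.
  have := is_deriveCD (is_deriveCM (DE0 0) (DE1 1))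
    (is_deriveCM (is_deriveC_cst (- 1) t) (is_deriveCM (DE1 0) (DE0 1))).
  under eq_fun do rewrite mulN1r.
  by move/is_deriveC_eq; apply; ring.
have {}DT : is_deriveC (fun u => 1 + s%:C * (g k u * conjc (g k u))) t
    (s%:C * (ptC g k t * conjc (g k t) + g k t * conjc (ptC g k t))).
  by apply: is_deriveC_eq DT _; ring.
have Dinv : is_deriveC (fun u => ((1 + s%:C * (g k u * conjc (g k u))) *
    \det (E k u))^-1) t
    (- (s%:C * (ptC g k t * conjc (g k t) + g k t * conjc (ptC g k t)) /
        (1 + s%:C * (g k t * conjc (g k t))) ^+ 2 / \det (E k t))).
  apply: is_deriveC_eq (is_deriveC_inv (mulf_neq0 T0 d0) (is_deriveCM DT Ddet)) _.
  by field; rewrite T0 d0.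
have DE0b l : is_deriveC (fun u => conjc (E k u l 0)) t
    (lambda%:C * (tau t)%:C / conjc (ptC g k t) * conjc (E k t l 1)).
  apply: is_deriveC_eq (is_deriveC_conj (DE0 l)) _.
  by rewrite !conjcM conjc_inv conjc_real rmorphM.
have DE1b l : is_deriveC (fun u => conjc (E k u l 1)) t
    (conjc (ptC g k t) * conjc (E k t l 0)).
  by apply: is_deriveC_eq (is_deriveC_conj (DE1 l)) _; rewrite rmorphM.
have Df l := is_deriveCD (is_deriveCM DT (DE0 l)) (is_deriveCM
  (is_deriveCM (is_deriveC_cst (- s%:C) t) (is_deriveC_conj Dg)) (DE1 l)).
have Dfb l := is_deriveCD (is_deriveCM DT (DE0b l)) (is_deriveCM
  (is_deriveCM (is_deriveC_cst (- s%:C) t) Dg) (DE1b l)).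
have [e1 e2] := tangent_ratio_F (E k t i 0) (E k t i 1) (conjc (E k t j 0))
  (conjc (E k t j 1)) lambda%:C (tau t)%:C T0 d0 g0 gb0.
rewrite /pt_spinor_sum conj_secondary_spinor; split.
  by apply: is_deriveC_eq (is_deriveCM Dinv (is_deriveCM (DE1 i) (DE1b j))) _.
have ratioE : (tangent_ratio k t)%:C =
    (1 + s%:C * (g k t * conjc (g k t))) ^+ 2 * lambda%:C * (tau t)%:C /
    (ptC g k t * conjc (ptC g k t)) - s%:C.
  by rewrite /tangent_ratio rmorphB !rmorphM fmorphV /= calTC sqnE.
rewrite ratioE -e2; move: (is_deriveCM Dinv (is_deriveCM (Df i) (Dfb j))).
move=> /is_deriveC_eq; under eq_fun => u do rewrite !mulNr -conj_secondary_spinor.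
by apply; rewrite (rmorphM _ lambda (tau t)) /=; ring.
Qed.

End WeierstrassEdge.

(** * Edges of a Weierstrass surface: planarity, circularity and the Weingarten relation *)

Section WeierstrassCurvature.
Variable R : realType.
Local Open Scope complex_scope.
Variables (D : set (int * R)) (hD : sd_domain D).
Variables (g : int -> R -> R[i]) (sigma : int -> R) (tau : R -> R).
Variables (s lambda : R) (E : int -> R -> 'M[R[i]]_2).
Hypothesis hW : weierstrass_data D g sigma tau s lambda E.

(** [rho] is the cross ratio of [g] on the edge; [chord] and its conjugate are the factors [p] and
    [pb] of [edge_ratio_F]. *)
Let rho k t := tau t / sigma k.
Let chord k t := Delta g k t * (1 + s%:C * (g k t * conjc (g (k + 1) t))).

(** The factor [nu] with [Delta (x - n) = nu Delta (x + n)], the discrete analogue of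
    [tangent_ratio]. *)
Definition chord_ratio k t : R :=
  calT g s k t * calT g s (k + 1) t * lambda * sigma k / sqn (Delta g k t) - s.

(** [pt_coef] and [Delta_coef] are the coefficients of [U] and [V] in [edge_planar_F]; the latter is
    real because its numerator adds a complex number to its conjugate. *)
Definition pt_coef k t : R :=
  - (rho k t * sqn (Delta g k t) * calT g s k t /
     (calT g s (k + 1) t * sqn (ptC g k t))).

Definition Delta_coef k t : R :=
  rho k t * (2 * complex.Re (conjc (ptC g k t) * chord k t)) /
  (calT g s (k + 1) t * sqn (ptC g k t)).

Lemma holomorphic_edge k t : edge D k t ->
  [/\ sigma k != 0, rho k t != 0, Delta g k t != 0, tau t = rho k t * sigma k
    & 1 - lambda%:C * (sigma k)%:C != 0 /\
      ptC g (k + 1) t = (rho k t)%:C * Delta g k t ^+ 2 / ptC g k t].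
Proof.
move=> ekt; have [[_ g0 hol] _ [_ ls] _ _] := hW.
have [dg0 holE st] := hol _ _ ekt.
have s0 : sigma k != 0.
  (* Division by zero returns zero, which is not negative. *)
  by apply: contraTneq st => ->; rewrite invr0 mulr0 ltxx.
have pg0 := g0 _ _ ekt.1.
split => //; first by rewrite lt_eqF.
  by rewrite /rho divfK.
split.
- have := ls _ _ ekt; rewrite -(fmorph_eq0 (real_complex R)).
  by rewrite rmorphB rmorphM rmorph1.
- by rewrite /rho -holE; field; rewrite pg0 dg0.
Qed.

(** The next frame is [E] times [1 + E^-1 Delta E], whose determinant is [1 - lambda * sigma]. *)
Lemma det_edge k t : edge D k t ->
  \det (E (k + 1) t) = \det (E k t) * (1 - lambda%:C * (sigma k)%:C).
Proof.
move=> ekt; have [_ _ dg0 _ _] := holomorphic_edge ekt.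
rewrite !det2 !(Delta_col hW _ ekt).1 !(Delta_col hW _ ekt).2 rmorphM /=.
by field.
Qed.

Lemma conj_chord k t : conjc (chord k t) =
  (conjc (g (k + 1) t) - conjc (g k t)) *
  (1 + s%:C * (conjc (g k t) * g (k + 1) t)).
Proof.
rewrite /chord conjcM; congr (_ * _); first exact: rmorphB.
have cD (z w : R[i]) : conjc (z + w) = conjc z + conjc w by exact: rmorphD.
by rewrite cD conjc1 !conjcM conjcK conjc_real.
Qed.

Lemma chord_ratioC k t : (chord_ratio k t)%:C =
  (1 + s%:C * (g k t * conjc (g k t))) *
  (1 + s%:C * (g (k + 1) t * conjc (g (k + 1) t))) * lambda%:C * (sigma k)%:C
  / (Delta g k t * conjc (Delta g k t)) - s%:C.
Proof. by rewrite /chord_ratio rmorphB !rmorphM fmorphV /= !calTC sqnE. Qed.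

Lemma pt_coefC k t : (pt_coef k t)%:C = - ((rho k t)%:C *
  (Delta g k t * conjc (Delta g k t)) * (1 + s%:C * (g k t * conjc (g k t))) /
  ((1 + s%:C * (g (k + 1) t * conjc (g (k + 1) t))) *
   (ptC g k t * conjc (ptC g k t)))).
Proof.
rewrite -!calTC -!sqnE /pt_coef; move: (rho k t) (calT _ _ _ _) => r T'.
by rewrite rmorphN !rmorphM fmorphV rmorphM.
Qed.

Lemma Delta_coefC k t : (Delta_coef k t)%:C = (rho k t)%:C *
  (conjc (ptC g k t) * chord k t + ptC g k t * conjc (chord k t)) /
  ((1 + s%:C * (g (k + 1) t * conjc (g (k + 1) t))) *
   (ptC g k t * conjc (ptC g k t))).
Proof.
have -> : conjc (ptC g k t) * chord k t + ptC g k t * conjc (chord k t) =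
    (2 * complex.Re (conjc (ptC g k t) * chord k t))%:C.
  move: (chord k t) => c; have := addcJ (conjc (ptC g k t) * c).
  by rewrite conjcM conjcK => ->; rewrite rmorphM rmorph_nat.
rewrite -calTC -sqnE /Delta_coef; move: (rho k t) (_ * complex.Re _) => r c.
by rewrite !rmorphM fmorphV rmorphM.
Qed.

Lemma spinor_edge k t i j : edge D k t ->
  let V := spinor_sum g s E (k + 1) t i j - spinor_sum g s E k t i j in
  [/\ V = ((1 + s%:C * (g k t * conjc (g k t))) ^+ 2 *
           (1 + s%:C * (g (k + 1) t * conjc (g (k + 1) t))) *
           (\det (E k t) * (1 - lambda%:C * (sigma k)%:C)))^-1 *
          (Delta g k t * conjc (Delta g k t) *
             (secondary_spinor g s E k t i * conjc (secondary_spinor g s E k t j))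
           + chord k t * secondary_spinor g s E k t i * conjc (E k t j 1)
           + conjc (chord k t) * E k t i 1 * conjc (secondary_spinor g s E k t j)
           + (chord_ratio k t)%:C * (Delta g k t * conjc (Delta g k t)) *
             (E k t i 1 * conjc (E k t j 1))),
      spinor_diff g s E (k + 1) t i j - spinor_diff g s E k t i j =
        (chord_ratio k t)%:C * V
    & pt_spinor_sum g s E (k + 1) t i j =
        (pt_coef k t)%:C * pt_spinor_sum g s E k t i j
        + (Delta_coef k t)%:C * V].
Proof.
move=> ekt V.
have [s0 r0 dg0 tauE [l0 ptE]] := holomorphic_edge ekt.
have T0 := calTC_neq0 hW ekt.1; have T10 := calTC_neq0 hW ekt.2.
have d0 := det_neq0 hW ekt.1; have g0 := ptC_neq0 hW ekt.1.
have gb0 : conjc (ptC g k t) != 0 by rewrite conjc_eq0.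
have dgb0 : conjc (Delta g k t) != 0 by rewrite conjc_eq0.
have cB (z w : R[i]) : conjc (z - w) = conjc z - conjc w by exact: rmorphB.
have cD (z w : R[i]) : conjc (z + w) = conjc z + conjc w by exact: rmorphD.
have dgE : Delta g k t = g (k + 1) t - g k t by [].
have dgbE : conjc (Delta g k t) = conjc (g (k + 1) t) - conjc (g k t) by rewrite -cB.
have E1 l := Delta_col hW l ekt.
rewrite dgE in dg0 ptE E1; rewrite dgbE in dgb0.
have E1b l : conjc (E (k + 1) t l 0) = conjc (E k t l 0) +
    lambda%:C * (sigma k)%:C / (conjc (g (k + 1) t) - conjc (g k t)) *
      conjc (E k t l 1) /\
    conjc (E (k + 1) t l 1) = conjc (E k t l 1) +
      (conjc (g (k + 1) t) - conjc (g k t)) * conjc (E k t l 0).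
  rewrite (E1 l).1 (E1 l).2 !cD !conjcM conjc_inv conjc_real !cB rmorphM.
  by [].
have ptbE : conjc (ptC g (k + 1) t) =
    (rho k t)%:C * (conjc (g (k + 1) t) - conjc (g k t)) ^+ 2 /
    conjc (ptC g k t).
  by rewrite ptE !conjcM conjc_inv conjc_real cB.
have e1 := edge_ratio_F (E k t i 0) (E k t i 1) (conjc (E k t j 0))
  (conjc (E k t j 1)) T0 T10 d0 l0 dg0 dgb0.
have e2 := edge_planar_F (E k t i 0) (E k t i 1) (conjc (E k t j 0))
  (conjc (E k t j 1)) (rho k t)%:C T0 T10 d0 l0 dg0 dgb0 g0 gb0.
have EE l : E (k + 1) t l 0 = E k t l 0 +
    lambda%:C * (sigma k)%:C / (g (k + 1) t - g k t) * E k t l 1.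
  by rewrite (E1 l).1 rmorphM.
rewrite /V /spinor_sum /spinor_diff /pt_spinor_sum !conj_secondary_spinor.
rewrite /secondary_spinor !(det_edge ekt) !(E1b _).1 !(E1b _).2 !EE !(E1 _).2.
rewrite ptbE ptE pt_coefC Delta_coefC conj_chord chord_ratioC dgbE /chord dgE.
have [e1a e1b] := e1; split; [exact: e1a|exact: e1b|exact: e2].
Qed.

(** * From spinor matrices to edge vectors in Minkowski space *)

Variables (x n : int -> R -> 'rV[R]_4).
Hypothesis hx : given_by D x (weierstrass_x g s E).
Hypothesis hn : given_by D n (weierstrass_n g s E).

Lemma herm_sum k t i j : D (k, t) ->
  herm (x k t) i j = spinor_sum g s E k t i j + spinor_diff g s E k t i j /\
  herm (n k t) i j = spinor_sum g s E k t i j - spinor_diff g s E k t i j.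
Proof.
move=> Dkt; have [_ T0 _ _ _] := hW.
by rewrite hx// hn//; exact: weierstrassE (T0 _ _ Dkt).
Qed.

Let c1D (a : R) : (1 + a)%:C = 1 + a%:C :> R[i].
Proof. by rewrite rmorphD rmorph1. Qed.
Let c1B (a : R) : (1 - a)%:C = 1 - a%:C :> R[i].
Proof. by rewrite rmorphB rmorph1. Qed.

Lemma pt_spinor k t : D (k, t) -> exists u : 'rV[R]_4,
  [/\ forall i j, herm u i j = pt_spinor_sum g s E k t i j,
      pt x k t = (1 + tangent_ratio g tau s lambda k t) *: u
    & pt n k t = (1 - tangent_ratio g tau s lambda k t) *: u].
Proof.
move=> Dkt; set mu := tangent_ratio _ _ _ _ _ _.
have nearD : \forall u \near t, D (k, u).
  by apply: open_nbhs_nbhs; split=> //; exact: hD.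
have dS i j := (spinor_derive hW i j Dkt).1.
have dQ i j := (spinor_derive hW i j Dkt).2.
have [_ px] : derivable (x k) t 1 /\ herm (pt x k t) =
    \matrix_(i, j) ((1 + mu)%:C * pt_spinor_sum g s E k t i j).
  apply: (@herm_derive _ _ _ (fun u => \matrix_(i, j)
    (spinor_sum g s E k u i j + spinor_diff g s E k u i j))).
    apply: filterS nearD => u Du; apply/matrixP => i j.
    by rewrite [RHS]mxE (herm_sum _ _ Du).1.
  move=> i j; rewrite mxE; under eq_fun do rewrite mxE.
  by apply: is_deriveC_eq (is_deriveCD (dS i j) (dQ i j)) _; rewrite c1D; ring.
have [_ pn] : derivable (n k) t 1 /\ herm (pt n k t) =
    \matrix_(i, j) ((1 - mu)%:C * pt_spinor_sum g s E k t i j).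
  apply: (@herm_derive _ _ _ (fun u => \matrix_(i, j)
    (spinor_sum g s E k u i j - spinor_diff g s E k u i j))).
    apply: filterS nearD => u Du; apply/matrixP => i j.
    by rewrite [RHS]mxE (herm_sum _ _ Du).2.
  move=> i j; rewrite mxE; under eq_fun do rewrite mxE -mulN1r.
  apply: is_deriveC_eq (is_deriveCD (dS i j)
    (is_deriveCM (is_deriveC_cst (- 1) t) (dQ i j))) _.
  by rewrite c1B; ring.
(* The factors [1 + mu] and [1 - mu] add up to [2], so half the sum is a vector with the wanted
   matrix even if one factor vanishes. *)
pose u : 'rV[R]_4 := 2^-1 *: ((pt x k t : 'rV[R]_4) + pt n k t).
have uE i j : herm u i j = pt_spinor_sum g s E k t i j.
  rewrite /u hermZ hermD px pn !mxE c1D c1B fmorphV rmorph_nat.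
  by field.
exists u; split=> //; apply: herm_inj; apply/matrixP => i j.
  by rewrite hermZ px [RHS]mxE uE mxE.
by rewrite hermZ pn [RHS]mxE uE mxE.
Qed.

Lemma Delta_spinor k t : edge D k t -> exists v : 'rV[R]_4,
  [/\ forall i j, herm v i j =
        spinor_sum g s E (k + 1) t i j - spinor_sum g s E k t i j,
      Delta x k t = (1 + chord_ratio k t) *: v
    & Delta n k t = (1 - chord_ratio k t) *: v].
Proof.
move=> ekt; set nu := chord_ratio k t; have [Dkt Dkt1] := ekt.
have dx i j : herm (Delta x k t) i j = (1 + nu)%:C *
    (spinor_sum g s E (k + 1) t i j - spinor_sum g s E k t i j).
  have [_ eQ _] := spinor_edge i j ekt; rewrite c1D mulrDl mul1r.
  rewrite -[_%:C * _]eQ /Delta hermB mxE [fun_of_matrix (- _) _ _]mxE.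
  by rewrite (herm_sum _ _ Dkt).1 (herm_sum _ _ Dkt1).1; ring.
have dn i j : herm (Delta n k t) i j = (1 - nu)%:C *
    (spinor_sum g s E (k + 1) t i j - spinor_sum g s E k t i j).
  have [_ eQ _] := spinor_edge i j ekt; rewrite c1B mulrBl mul1r.
  rewrite -[_%:C * _]eQ /Delta hermB mxE [fun_of_matrix (- _) _ _]mxE.
  by rewrite (herm_sum _ _ Dkt).2 (herm_sum _ _ Dkt1).2; ring.
pose v : 'rV[R]_4 := 2^-1 *: ((Delta x k t : 'rV[R]_4) + Delta n k t).
have vE i j : herm v i j =
    spinor_sum g s E (k + 1) t i j - spinor_sum g s E k t i j.
  rewrite /v hermZ hermD mxE [fun_of_matrix (_ + _) _ _]mxE dx dn c1D c1B.
  rewrite fmorphV rmorph_nat.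
  by field.
exists v; split=> //; apply: herm_inj; apply/matrixP => i j.
  by rewrite hermZ dx [RHS]mxE vE.
by rewrite hermZ dn [RHS]mxE vE.
Qed.

Lemma weingarten_relation k t : edge D k t ->
  let al := pt_coef k t in
  (tangent_ratio g tau s lambda k t
     + al * tangent_ratio g tau s lambda (k + 1) t)
  + (1 + al) * chord_ratio k t + 2 * s * (1 + al) = 0.
Proof.
move=> ekt; have [s0 r0 dg0 tauE [_ ptE]] := holomorphic_edge ekt.
have [_ T0 _ _ _] := hW; have g0 := ptC_neq0 hW ekt.1.
(* Squared modulus of the holomorphicity equation: this is [dd1] of [weingarten_F]. *)
have sqE : sqn (ptC g (k + 1) t) =
    rho k t ^+ 2 * sqn (Delta g k t) ^+ 2 / sqn (ptC g k t).
  apply: complexI; rewrite sqnE ptE; move: (rho k t) => r.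
  have cE (q p : R) : (r ^+ 2 * q ^+ 2 / p)%:C = r%:C ^+ 2 * q%:C ^+ 2 / p%:C.
    by rewrite !rmorphM fmorphV.
  rewrite cE !sqnE !conjcM conjc_inv conjc_real.
  have gb0 : conjc (ptC g k t) != 0 by rewrite conjc_eq0.
  by field; rewrite g0 gb0.
rewrite /tangent_ratio sqE tauE /chord_ratio /pt_coef.
by apply: weingarten_F; rewrite ?sqn_eq0 ?T0//; exact: ekt.2.
Qed.

Lemma weierstrass_edge k t : edge D k t ->
  exists u u1 v : 'rV[R]_4, exists mu mu1 nu al be : R,
  [/\ [/\ pt x k t = (1 + mu) *: u, pt x (k + 1) t = (1 + mu1) *: u1
        & Delta x k t = (1 + nu) *: v],
      [/\ pt n k t = (1 - mu) *: u, pt n (k + 1) t = (1 - mu1) *: u1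
        & Delta n k t = (1 - nu) *: v],
      u1 = al *: u + be *: v,
      2 * al * lor u v + be * lor v v = 0
    & (mu + al * mu1) + (1 + al) * nu + 2 * s * (1 + al) = 0].
Proof.
move=> ekt; have [u [uE pxE pnE]] := pt_spinor ekt.1.
have [u1 [u1E px1E pn1E]] := pt_spinor ekt.2.
have [v [vE dxE dnE]] := Delta_spinor ekt.
exists u, u1, v, (tangent_ratio g tau s lambda k t).
exists (tangent_ratio g tau s lambda (k + 1) t), (chord_ratio k t).
exists (pt_coef k t), (Delta_coef k t); split=> //.
- apply: herm_inj; apply/matrixP => i j; have [_ _ e] := spinor_edge i j ekt.
  rewrite u1E e hermD !hermZ mxE [_ (_ *: herm u) _ _]mxE.
  by rewrite [_ (_ *: herm v) _ _]mxE uE vE.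
- have [s0 r0 dg0 tauE [l0 ptE]] := holomorphic_edge ekt.
  have T0 := calTC_neq0 hW ekt.1; have T10 := calTC_neq0 hW ekt.2.
  have d0 := det_neq0 hW ekt.1; have g0 := ptC_neq0 hW ekt.1.
  have gb0 : conjc (ptC g k t) != 0 by rewrite conjc_eq0.
  have dgbE : conjc (Delta g k t) = conjc (g (k + 1) t) - conjc (g k t).
    exact: rmorphB.
  have dgb0 : conjc (g (k + 1) t) - conjc (g k t) != 0.
    by rewrite -dgbE conjc_eq0.
  have vE' i j := let: And3 e _ _ := spinor_edge i j ekt in e.
  have := edge_circular_F (secondary_spinor g s E k t 0)
    (secondary_spinor g s E k t 1) (E k t 0 1) (E k t 1 1)
    (conjc (secondary_spinor g s E k t 0))
    (conjc (secondary_spinor g s E k t 1)) (conjc (E k t 0 1))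
    (conjc (E k t 1 1)) (rho k t)%:C T0 T10 d0 l0 dg0 dgb0 g0 gb0.
  (* The real identity is moved to the complex numbers and negated, because determinants are minus
     Lorentz products. *)
  move=> /= circ; apply: complexI; apply: oppr_inj; rewrite -[RHS]rmorphN oppr0.
  have -> : - (2 * pt_coef k t * lor u v + Delta_coef k t * lor v v)%:C =
    (pt_coef k t)%:C * (- 2 * lor u v)%:C
    + (Delta_coef k t)%:C * (- lor v v)%:C.
    by rewrite -!rmorphM -rmorphD -rmorphN /=; congr _%:C; ring.
  rewrite lor_herm lor_herm_det !uE !vE !vE'.
  rewrite /pt_spinor_sum pt_coefC Delta_coefC conj_chord chord_ratioC dgbE /chord.
  exact: circ.
- exact: weingarten_relation.
Qed.

Lemma weierstrass_circularity : circularity D x /\ circularity D n.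
Proof.
split=> k t ekt; have [u [u1 [v [mu [mu1 [nu [al [be [hX hN u1E circ _]]]]]]]]] :=
  weierstrass_edge ekt; subst u1; rewrite /tangent_cross_ratio.
- have [-> -> ->] := hX.
  exact: (real_cross_ratioZ _ _ (real_cross_ratio_planar circ)).
- have [-> -> ->] := hN.
  exact: (real_cross_ratioZ _ _ (real_cross_ratio_planar circ)).
Qed.

Lemma weierstrass_weingarten k t : edge D k t ->
  (mixed_area x x k t <> 0 -> curvatures_defined x n k t /\
     2 * s * (mean_curv x n k t - 1)
       + (1 - s) * (gauss_curv x n k t - 1) = 0) /\
  (mixed_area n n k t <> 0 -> curvatures_defined n x k t /\
     2 * s * (mean_curv n x k t - 1)
       - (1 + s) * (gauss_curv n x k t - 1) = 0).
Proof.
move=> ekt; have [u [u1 [v [mu [mu1 [nu [al [be [hX hN u1E _ W]]]]]]]]] :=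
  weierstrass_edge ekt; subst u1.
have [px px1 dx] := hX; have [pn pn1 dn] := hN.
have frame (a b : R) : a *: u + b *: (al *: u + be *: v) =
    (a + b * al) *: u + (b * be) *: v.
  by rewrite scalerDr !scalerA addrA -scalerDl.
have sx : pt x k t + pt x (k + 1) t =
    ((1 + mu) + (1 + mu1) * al) *: u + ((1 + mu1) * be) *: v.
  by rewrite px px1; exact: frame.
have sn : pt n k t + pt n (k + 1) t =
    ((1 - mu) + (1 - mu1) * al) *: u + ((1 - mu1) * be) *: v.
  by rewrite pn pn1; exact: frame.
split=> A0.
- have [ab0 C -> ->] := curvature_frame sx dx sn dn A0; split=> //.
  (* Over the common denominator [a * b] of the curvatures, the left side is [- 2] times the edge
     relation [W]. *)
  move: ab0; rewrite mulf_eq0 negb_or => /andP[a0 b0].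
  transitivity (- 2 * ((mu + al * mu1) + (1 + al) * nu + 2 * s * (1 + al)) /
    ((1 + mu + (1 + mu1) * al) * (1 + nu))); last by rewrite W mulr0 mul0r.
  by field; rewrite a0 b0.
- have [ab0 C -> ->] := curvature_frame sn dn sx dx A0; split=> //.
  move: ab0; rewrite mulf_eq0 negb_or => /andP[a0 b0].
  transitivity (- 2 * ((mu + al * mu1) + (1 + al) * nu + 2 * s * (1 + al)) /
    ((1 - mu + (1 - mu1) * al) * (1 - nu))); last by rewrite W mulr0 mul0r.
  by field; rewrite a0 b0.
Qed.

End WeierstrassCurvature.

(** * Parallel surfaces of a Weierstrass surface *)

Section ParallelWeierstrass.
Variable R : realType.
Local Open Scope complex_scope.
Variables (D : set (int * R)) (hD : sd_domain D).

Lemma sd_mapC_scale (c : R) (f : int -> R -> R[i]) :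
  sd_mapC D f -> sd_mapC D (fun k t => c%:C * f k t).
Proof.
(* The zero summand gives the shape of [smooth_on_lincomb]. *)
have reE (z : R[i]) : complex.Re (c%:C * z) =
    c *: (complex.Re z : R^o) + 0 *: (complex.Re z : R^o).
  by rewrite ReM /= mul0r subr0 scale0r addr0.
have imE (z : R[i]) : complex.Im (c%:C * z) =
    c *: (complex.Im z : R^o) + 0 *: (complex.Im z : R^o).
  by rewrite ImM /= mul0r addr0 scale0r addr0.
move=> [fr fi]; split=> k; have oD : open [set t | D (k, t)] by exact: hD.
  have := @smooth_on_lincomb _ _ _ _ _ c 0 oD (fr k) (fr k); congr smooth_on.
  by apply/funext => u; rewrite reE.
have := @smooth_on_lincomb _ _ _ _ _ c 0 oD (fi k) (fi k); congr smooth_on.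
by apply/funext => u; rewrite imE.
Qed.

Lemma ptC_scale (c : R) (f : int -> R -> R[i]) k t : sd_mapC D f -> D (k, t) ->
  ptC (fun k t => c%:C * f k t) k t = c%:C * ptC f k t.
Proof.
move=> sf Dkt.
apply: is_deriveC_unique (sd_mapC_derive (sd_mapC_scale c sf) Dkt) _.
apply: is_deriveC_eq (is_deriveCM (is_deriveC_cst c%:C t) (sd_mapC_derive sf Dkt)) _.
by rewrite mul0r add0r.
Qed.

Variables (g : int -> R -> R[i]) (sigma : int -> R) (tau : R -> R).
Variables (s lambda theta : R) (E : int -> R -> 'M[R[i]]_2).

(** All exponentials become powers of [a]: [exp theta = a^2] and [exp(- 2 theta) = a^-4], so that
    [field] applies. *)
Let a := expR (theta / 2).
Let g' k t := (expR theta)%:C * g k t.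
Let s' := expR (- 2 * theta) * s.
Let E' k t := E k t *m mx2 (a^-1)%:C 0 0 a%:C.

Let a0 : a != 0. Proof. by rewrite expR_eq0. Qed.
Let aC0 : a%:C != 0. Proof. by rewrite fmorph_eq0. Qed.
Let aVC : (a^-1)%:C = a%:C^-1. Proof. exact: fmorphV. Qed.
Let expRE2 : expR theta = a ^+ 2.
Proof. by rewrite expr2 -expRD -splitr. Qed.
Let expRCE : (expR theta)%:C = a%:C ^+ 2.
Proof. by rewrite expRE2 rmorphXn. Qed.
Let expRNCE : (expR (- theta))%:C = (a%:C ^+ 2)^-1.
Proof. by rewrite expRN -expRCE; exact: fmorphV. Qed.
Let sE : s' = s / a ^+ 4.
Proof.
by rewrite /s' mulNr expRN mulr_natl mulr2n expRD expRE2 mulrC; field.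
Qed.

Let colE k t i : E' k t i 0 = (a^-1)%:C * E k t i 0 /\
  E' k t i 1 = a%:C * E k t i 1.
Proof.
by rewrite /E' !mulmx2E ![mx2 _ _ _ _ _ _]mxE /=; split; ring.
Qed.

Let detP : \det (mx2 (a^-1)%:C 0 0 a%:C) = 1.
Proof. by rewrite det2 !mxE /= mul0r subr0 aVC mulVf. Qed.

Let detE' k t : \det (E' k t) = \det (E k t).
Proof. by rewrite det_mulmx detP mulr1. Qed.

Lemma calT_parallel k t : calT g' s' k t = calT g s k t.
Proof.
rewrite !calT_sqn; congr (1 + _); apply: complexI.
have cM (p q : R) : (p * q)%:C = p%:C * q%:C by exact: rmorphM.
rewrite (cM s' _) (cM s _) !sqnE /g' conjcM conjc_real.
have -> : s'%:C = s%:C / a%:C ^+ 4 by rewrite sE cM fmorphV rmorphXn.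
by rewrite expRCE; field.
Qed.

(** Scaling [g] by a constant preserves its cross ratio, hence [sigma] and [tau]. Multiplying [E] by
    the constant diagonal matrix conjugates the frame equations, which scales their off-diagonal
    entries to those of [g']. *)
Lemma parallel_data : weierstrass_data D g sigma tau s lambda E ->
  weierstrass_data D g' sigma tau s' lambda E'.
Proof.
move=> [[sg g0 hol] T0 ls [sM Eu Er] [hDE hpE]].
have c0 : (expR theta)%:C != 0 by rewrite fmorph_eq0 expR_eq0.
have ptg k t : D (k, t) -> ptC g' k t = (expR theta)%:C * ptC g k t.
  exact: ptC_scale.
have Dg k t : Delta g' k t = (expR theta)%:C * Delta g k t.
  by rewrite /Delta /g' mulrBr.
have E'u k t : D (k, t) -> E' k t \in unitmx.
  by move=> Dkt; rewrite unitmxE detE' -unitmxE Eu.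
have conjP (z : R[i]) (c : R) : z != 0 ->
    mx2 0 z (c%:C / z) 0 *m mx2 (a^-1)%:C 0 0 a%:C =
    mx2 (a^-1)%:C 0 0 a%:C *m
    mx2 0 ((expR theta)%:C * z) (c%:C / ((expR theta)%:C * z)) 0.
  move=> z0; rewrite expRCE aVC; apply: mx2P; rewrite !mulmx2E !mxE /=; field;
  by rewrite ?z0 ?aC0.
split.
- split.
  + exact: sd_mapC_scale.
  + by move=> k t Dkt; rewrite ptg// mulf_neq0// g0.
  + move=> k t ekt; have [h1 h2 h3] := hol k t ekt.
    rewrite Dg (ptg _ _ ekt.1) (ptg _ _ ekt.2); split=> //.
      by rewrite mulf_neq0.
    by rewrite -h2; field; rewrite c0 h1.
- by move=> k t Dkt; rewrite calT_parallel T0.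
- by [].
- split.
  + move=> i; elim/ord2P.
      have := sd_mapC_scale a^-1 (sM i 0); congr sd_mapC.
      by apply/funext => k; apply/funext => t; rewrite (colE k t i).1.
    have := sd_mapC_scale a (sM i 1); congr sd_mapC.
    by apply/funext => k; apply/funext => t; rewrite (colE k t i).2.
  + exact: E'u.
  + by move=> k t Dkt; rewrite detE' Er.
- split.
  + move=> k t ekt; have [h1 _ _] := hol k t ekt.
    have -> : Delta E' k t = Delta E k t *m mx2 (a^-1)%:C 0 0 a%:C.
      by rewrite /Delta /E' mulmxBl.
    have -> : Delta E k t = E k t *m mx2 0 (Delta g k t)
        ((lambda * sigma k)%:C / Delta g k t) 0.
      by rewrite -hDE// mulKVmx// Eu//; case: ekt.
    rewrite -mulmxA conjP// mulmxA Dg mulKmx//.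
    exact: E'u ekt.1.
  + move=> k t Dkt.
    have -> : ptM E' k t = ptM E k t *m mx2 (a^-1)%:C 0 0 a%:C.
      apply/matrixP => i.
      have p0 : ptC (fun k t => E' k t i 0) k t = (a^-1)%:C * ptM E k t i 0.
        rewrite [ptM _ _ _ _ _]mxE.
        transitivity (ptC (fun k t => (a^-1)%:C * E k t i 0) k t); last first.
          exact: ptC_scale (sM i 0) Dkt.
        apply: (congr1 (fun F => ptC F k t)).
        by apply/funext => l; apply/funext => u; rewrite (colE l u i).1.
      have p1 : ptC (fun k t => E' k t i 1) k t = a%:C * ptM E k t i 1.
        rewrite [ptM _ _ _ _ _]mxE.
        transitivity (ptC (fun k t => (a)%:C * E k t i 1) k t); last first.
          exact: ptC_scale (sM i 1) Dkt.
        apply: (congr1 (fun F => ptC F k t)).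
        by apply/funext => l; apply/funext => u; rewrite (colE l u i).2.
      elim/ord2P; rewrite [LHS]mxE ?p0 ?p1 mulmx2E ![mx2 _ _ _ _ _ _]mxE /=.
        by rewrite mulr0 addr0 mulrC.
      by rewrite mulr0 add0r mulrC.
    have -> : ptM E k t = E k t *m mx2 0 (ptC g k t)
        ((lambda * tau t)%:C / ptC g k t) 0.
      by rewrite -hpE// mulKVmx// Eu.
    rewrite -mulmxA conjP ?g0// mulmxA ptg// mulKmx//.
    exact: E'u.
Qed.

(** This spinor scales by [1 / a] and the second column of [E] by [a], so [x - n] scales by
    [exp(- theta)] and [x + n] by [exp theta]. *)
Lemma secondary_spinor_parallel k t i :
  secondary_spinor g' s' E' k t i = a%:C^-1 * secondary_spinor g s E k t i.
Proof.
have TE := calT_parallel k t.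
have s'C : s'%:C = s%:C / a%:C ^+ 4.
  by rewrite sE; move: (a) => b; rewrite rmorphM fmorphV rmorphXn.
rewrite /secondary_spinor -!calTC TE (colE k t i).1 (colE k t i).2 s'C aVC.
by rewrite /g' conjcM conjc_real expRCE; field.
Qed.

Lemma parallel_given (x n : int -> R -> 'rV[R]_4) :
  weierstrass_data D g sigma tau s lambda E ->
  given_by D x (weierstrass_x g s E) -> given_by D n (weierstrass_n g s E) ->
  given_by D (parallel_x theta x n) (weierstrass_x g' s' E') /\
  given_by D (parallel_n theta x n) (weierstrass_n g' s' E').
Proof.
move=> hW hx hn.
have key k t i j : D (k, t) ->
  [/\ herm (x k t) i j = spinor_sum g s E k t i j + spinor_diff g s E k t i j,
      herm (n k t) i j = spinor_sum g s E k t i j - spinor_diff g s E k t i j,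
      weierstrass_x g' s' E' k t i j = (expR theta)%:C * spinor_sum g s E k t i j
        + (expR (- theta))%:C * spinor_diff g s E k t i j
    & weierstrass_n g' s' E' k t i j = (expR theta)%:C * spinor_sum g s E k t i j
        - (expR (- theta))%:C * spinor_diff g s E k t i j].
  move=> Dkt; have [_ T0 _ _ _] := hW.
  have T0' : calT g' s' k t != 0 by rewrite calT_parallel T0.
  have [kx kn] := herm_sum hW hx hn i j Dkt.
  have [wx wn] := weierstrassE E' i j T0'.
  have sumE : spinor_sum g' s' E' k t i j =
      (expR theta)%:C * spinor_sum g s E k t i j.
    rewrite /spinor_sum -!calTC calT_parallel detE' !(colE k t _).2 expRCE.
    by rewrite conjcM conjc_real; ring.
  have diffE : spinor_diff g' s' E' k t i j =
      (expR (- theta))%:C * spinor_diff g s E k t i j.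
    rewrite /spinor_diff -!calTC calT_parallel detE' !secondary_spinor_parallel.
    rewrite expRNCE conjcM conjc_inv conjc_real expr2 !invfM.
    by ring.
  by split; [exact: kx|exact: kn|rewrite [LHS]wx sumE diffE
    |rewrite [LHS]wn sumE diffE].
(* The hyperbolic rotation defining the parallel pair is diagonal on the null directions [x + n] and
   [x - n]. *)
have chC (z w : R[i]) : (cosh theta)%:C * (z + w) + (sinh theta)%:C * (z - w) =
    (expR theta)%:C * z + (expR (- theta))%:C * w.
  rewrite /cosh /sinh !(rmorphM _ (_ + _)) !rmorphD rmorphN fmorphV rmorph_nat.
  by field.
have shC (z w : R[i]) : (sinh theta)%:C * (z + w) + (cosh theta)%:C * (z - w) =
    (expR theta)%:C * z - (expR (- theta))%:C * w.
  rewrite /cosh /sinh !(rmorphM _ (_ + _)) !rmorphD rmorphN fmorphV rmorph_nat.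
  by field.
split=> k t Dkt; apply/matrixP => i j; have [kx kn kX kN] := key k t i j Dkt.
  rewrite kX -chC -kx -kn /parallel_x hermD !hermZ mxE.
  by congr (_ + _); rewrite mxE.
rewrite kN -shC -kx -kn /parallel_n hermD !hermZ mxE.
by congr (_ + _); rewrite mxE.
Qed.

End ParallelWeierstrass.

Theorem proposition4p4 (R : realType) (D : set (int * R)) (hD : sd_domain D)
    (x n : int -> R -> 'rV[R]_4) (theta : R) :
  let xt := parallel_x theta x n in
  let nt := parallel_n theta x n in
  (circular_surface D x n ->
    [/\ unit_normal D xt nt,
        circularity D xt,
        (forall k t, edge D k t ->
           mixed_area x x k t <> 0 -> mixed_area xt xt k t <> 0 ->
           let K0 := gauss_curv x n k t in
           let H0 := mean_curv x n k t in
           let denom := cosh theta ^+ 2 - H0 * sinh (2 * theta)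
                        + K0 * sinh theta ^+ 2 in
           [/\ curvatures_defined x n k t,
               curvatures_defined xt nt k t,
               gauss_curv xt nt k t
                 = (K0 * cosh theta ^+ 2 - H0 * sinh (2 * theta)
                    + sinh theta ^+ 2) / denom
             & mean_curv xt nt k t
                 = (- (K0 + 1) * sinh (2 * theta)
                    + 2 * H0 * cosh (2 * theta)) / (2 * denom)])
      & circularity D nt])
  /\
  (forall (g : int -> R -> R[i]) (sigma : int -> R) (tau : R -> R)
      (s lambda : R) (E : int -> R -> 'M[R[i]]_2),
    weierstrass_data D g sigma tau s lambda E ->
    given_by D x (weierstrass_x g s E) ->
    given_by D n (weierstrass_n g s E) ->
    let st := expR (- 2 * theta) * s in
    [/\ circularity D xt,
        (forall k t, edge D k t -> mixed_area xt xt k t <> 0 ->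
           curvatures_defined xt nt k t /\
           2 * st * (mean_curv xt nt k t - 1)
             + (1 - st) * (gauss_curv xt nt k t - 1) = 0)
      & is_BrLW D xt]
    /\
    [/\ circularity D nt,
        (forall k t, edge D k t -> mixed_area nt nt k t <> 0 ->
           curvatures_defined nt xt k t /\
           2 * st * (mean_curv nt xt k t - 1)
             - (1 + st) * (gauss_curv nt xt k t - 1) = 0)
      & is_BiLW D nt]).
Proof.
move=> xt nt; split=> [hc|g sigma tau s lambda E hW hx hn st].
  have [un _ _] := hc; split.
  - exact: parallel_unit_normal.
  - exact: parallel_circularity.
  - by move=> k t ekt A0 At0; exact: (parallel_curvature hc ekt A0 At0).
  - exact: parallel_circularity.
(* The parallel pair is itself a Weierstrass pair with constant [st], so both claims are the
   unrotated ones for the new data. *)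
have hW' := parallel_data hD theta hW.
have [hx' hn'] := parallel_given theta hW hx hn.
have [cx cn] := weierstrass_circularity hD hW' hx' hn'.
have lw k t := weierstrass_weingarten hD hW' hx' hn' (k := k) (t := t).
split; split.
- exact: cx.
- by move=> k t ekt; exact: (lw k t ekt).1.
- by do 6 eexists; split; [exact: hW'|exact: hx'].
- exact: cn.
- by move=> k t ekt; exact: (lw k t ekt).2.
- by do 6 eexists; split; [exact: hW'|exact: hn'].
Qed.
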